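(* There is an absolute constant $C>0$ such that, with probability tending to $1$ as $n\to\infty$, a uniformly random automaton with $n$ states on a $2$-letter alphabet has a synchronizing word of length at most $C\sqrt{n}\,\log(n)$.
   Context: An automaton with $n$ states on the alphabet $\{a,b\}$ is a pair of maps $a,b:[n]\to[n]$, where $[n]=\{1,\dots,n\}$. A uniformly random automaton is chosen uniformly among the $n^{2n}$ such pairs. A word $\omega=\omega_1\cdots\omega_t\in\{a,b\}^*$ acts on $[n]$ by $\omega(u)=\omega_t(\omega_{t-1}(\cdots\omega_1(u)\cdots))$; its length is $t$. The word $\omega$ is synchronizing if there is $v_0\in[n]$ such that $\omega(u)=v_0$ for all $u\in[n]$. *)

(* Defs.v *)
From mathcomp Require Import all_boot all_order all_algebra.
From mathcomp Require Import all_classical all_reals all_analysis.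

Set Implicit Arguments.
Unset Strict Implicit.
Unset Printing Implicit Defensive.

Import Order.TTheory GRing.Theory Num.Theory.
Import numFieldNormedType.Exports.

Local Open Scope ring_scope.

Inductive letter : Type := La | Lb.

(* The pair (a, b) of transition maps; the states 1, ..., n are shifted to
   0, ..., n - 1. *)
Definition automaton (n : nat) : finType :=
  ({ffun 'I_n -> 'I_n} * {ffun 'I_n -> 'I_n})%type.

Definition transition (n : nat) (A : automaton n) (u : 'I_n) (c : letter) : 'I_n :=
  match c with
  | La => A.1 u
  | Lb => A.2 u
  end.

(* The first letter of the word acts first. *)
Definition word_act (n : nat) (A : automaton n) (w : seq letter) (u : 'I_n) :
    'I_n :=
  foldl (transition A) u w.

Definition synchronizing (n : nat) (A : automaton n) (w : seq letter) : Prop :=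
  exists v0 : 'I_n, forall u : 'I_n, word_act A w u = v0.

Definition finite_uniform_prob (R : realType) (T : finType) (E : T -> Prop) : R :=
  #|[pred x : T | `[< E x >]]|%:R / #|T|%:R.

(* Main.v *)
(** Write lam for log2 n. With high probability no path of length of order
sqrt n * lam is simple under the letter a, so a power of a of that length maps
the states to the O(sqrt n) periodic ones. The remaining states are merged by
words a^j b (a?) b (a?) ... b a^T, where T is a large constant times lam and the
number D of optional letters is lam minus a constant. A uniformly random pair of
states is merged by a^T with probability of order T / n, because the image of
a^T has O(n / T) elements. Exploring the random map b breadth first along the
binary tree of these words, the 2^D leaves are almost fresh random pairs, so
every given pair of states (with distinct iterates under a) is merged by at least
lam words, except with probability o(n^-2); hence this holds for all pairs.

Averaging over words, some word then merges a number of pairs of a given set of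
order sqrt n that tends to infinity with n, so it removes more than any constant
number of states at cost O(lam). This brings the set down to a small constant
times sqrt n in O(sqrt n * lam) letters, after which it is enough to merge one
pair at a time. *)

Require Import Defs.
From mathcomp Require Import all_boot all_order all_algebra.
From mathcomp Require Import zify ring lra.

Set Implicit Arguments.
Unset Strict Implicit.
Unset Printing Implicit Defensive.

Import Order.TTheory GRing.Theory Num.Theory.

Local Open Scope ring_scope.


(** * Averages over finite types *)

Section Averages.
Variable R : realFieldType.
Implicit Types T : finType.

(** The union bound over pairs of states needs a failure probability well below [n ^ -2]. It comes
    from the mean of [2 ^ -X], where [X] counts the merging words: this mean multiplies over
    disjoint pairs explored together, and Markov's inequality turns it into a bound on the event
    that [X] is small. Ten disjoint iterates of one pair yield about [2 ^ (-4 lam)] up to powers of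
    [lam], against [n ^ 2] pairs and a factor [2 ^ lam] lost in Markov.

    The constant in the length must not depend on the tolerated failure probability, which is of
    order [1 / s] for a free parameter [s]. A merging word, however, has length up to [c * lam] with
    [c] depending on [s]. This is balanced by removing [r = s * c] states per word while the set is
    large, and by merging single pairs only once about [sqrt n / c] states remain. Asking for [lam]
    merging words per pair, instead of one, is what allows [r] and [c] to be arbitrary constants. *)

Definition avg T (f : T -> R) : R := (\sum_x f x) / #|T|%:R.

Lemma eq_avg T (f g : T -> R) : f =1 g -> avg f = avg g.
Proof. by move=> fg; rewrite /avg (eq_bigr g). Qed.

Lemma le_avg T (f g : T -> R) : (forall x, f x <= g x) -> avg f <= avg g.
Proof. by move=> fg; rewrite ler_wpM2r ?invr_ge0 ?ler0n //; apply: ler_sum. Qed.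

Lemma avg_ge0 T (f : T -> R) : (forall x, 0 <= f x) -> 0 <= avg f.
Proof. by move=> f0; rewrite mulr_ge0 ?invr_ge0 ?ler0n // sumr_ge0. Qed.

Lemma avgD T (f g : T -> R) : avg (fun x => f x + g x) = avg f + avg g.
Proof. by rewrite /avg big_split /= mulrDl. Qed.

Lemma avgN T (f : T -> R) : avg (fun x => - f x) = - avg f.
Proof. by rewrite /avg sumrN mulNr. Qed.

Lemma avgB T (f g : T -> R) : avg (fun x => f x - g x) = avg f - avg g.
Proof. by rewrite avgD avgN. Qed.

Lemma avgZ T c (f : T -> R) : avg (fun x => c * f x) = c * avg f.
Proof. by rewrite /avg -mulr_sumr mulrA. Qed.

Lemma avgZr T c (f : T -> R) : avg (fun x => f x * c) = avg f * c.
Proof. by rewrite mulrC -avgZ; apply: eq_avg => x; rewrite mulrC. Qed.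

Lemma avg_cst T (c : R) : (0 < #|T|)%N -> avg (fun _ : T => c) = c.
Proof.
move=> T0; rewrite /avg sumr_const -[c *+ _]mulr_natr mulfK //.
by rewrite pnatr_eq0 -lt0n.
Qed.

Lemma avg_sum T I (r : seq I) (P : pred I) (f : I -> T -> R) :
  avg (fun x => \sum_(i <- r | P i) f i x) = \sum_(i <- r | P i) avg (f i).
Proof. by rewrite /avg exchange_big /= mulr_suml. Qed.

Lemma avg_avg T T' (f : T -> T' -> R) :
  avg (fun x => avg (f x)) = avg (fun y => avg (fun x => f x y)).
Proof.
rewrite /avg -!mulr_suml exchange_big /= -!mulrA; congr (_ * _).
by rewrite mulrC.
Qed.

Lemma avg_pair T T' (f : T * T' -> R) :
  avg f = avg (fun x => avg (fun y => f (x, y))).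
Proof.
rewrite /avg -mulr_suml card_prod natrM invfM -mulrA; congr (_ * _); last first.
  by rewrite mulrC.
by rewrite pair_big; apply: eq_bigr => -[].
Qed.

Lemma avg_card T (P : pred T) : avg (fun x => (P x)%:R) = #|P|%:R / #|T|%:R.
Proof. by rewrite /avg -natr_sum -big_mkcond sum1_card. Qed.

Lemma avg0 T : avg (fun _ : T => 0) = 0.
Proof. by rewrite /avg big1 ?mul0r. Qed.

Lemma avg_eq_op T (v : T) : avg (fun p : T => (p == v)%:R) = #|T|%:R^-1.
Proof. by rewrite (avg_card (pred1 v)) card1 mul1r. Qed.

Lemma avg_markov T (f : T -> R) (c : R) : 0 < c -> (forall x, 0 <= f x) ->
  avg (fun x => (c < f x)%R%:R) <= avg f / c.
Proof.
move=> c0 f0; rewrite -avgZr; apply: le_avg => x.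
case: ltP => [cf|_]; last by rewrite divr_ge0 // ltW.
by rewrite ler_pdivlMr // mul1r ltW.
Qed.

Lemma sqr_avg_le T (f : T -> R) : avg f ^+ 2 <= avg (fun x => f x ^+ 2).
Proof.
have [T0|T0] := posnP #|T|.
  by rewrite /avg T0 invr0 !mulr0 expr0n.
have : 0 <= avg (fun x => (f x - avg f) ^+ 2) by apply: avg_ge0 => x; apply: sqr_ge0.
rewrite (eq_avg (g := fun x => f x ^+ 2 + ((- (2 * avg f)) * f x + avg f ^+ 2))).
  by rewrite !avgD avgZ avg_cst //; lra.
by move=> x; ring.
Qed.

End Averages.

(** * Resampling and revealing values of a random map *)

Section Resampling.
Variables (R : realFieldType) (V : finType).
Implicit Types (b : {ffun V -> V}) (K : {set V}).

Definition upd b x v : {ffun V -> V} := [ffun y => if y == x then v else b y].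

Lemma upd_same b x v : upd b x v x = v. Proof. by rewrite ffunE eqxx. Qed.

Lemma upd_other b x v y : y != x -> upd b x v y = b y.
Proof. by rewrite ffunE => /negPf ->. Qed.

(** Exchanging [b x] with an independent uniform [v] is an involution on the pairs [(b, v)], so the
    resampled map is again uniform. Independence between values of one random map always enters
    through this identity. *)
Lemma avg_upd (F : {ffun V -> V} -> R) x :
  avg F = avg (fun b => avg (fun v => F (upd b x v))).
Proof.
have V0 : (0 < #|V|)%N by apply/card_gt0P; exists x.
pose h (p : {ffun V -> V} * V) := (upd p.1 x p.2, p.1 x).
have hK : involutive h.
  move=> [b v]; rewrite /h /= upd_same; congr pair.
  by apply/ffunP=> y; rewrite !ffunE; case: eqP => // ->.
rewrite -(avg_pair (fun p => F (upd p.1 x p.2))).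
have -> : avg F = avg (fun p : {ffun V -> V} * V => F p.1).
  by rewrite avg_pair; apply: eq_avg => b /=; rewrite avg_cst.
rewrite /avg (reindex_inj (inv_inj hK)).
by congr (_ / _); apply: eq_bigr => -[].
Qed.

(** Conditioning without conditional probabilities: the values on [K] are already revealed and
    stored in [b0], the others are still random. [avg_mrg] reveals one more value. *)
Definition mrg K b0 b : {ffun V -> V} := [ffun y => if y \in K then b0 y else b y].

Lemma avg_mrg K b0 x (F : {ffun V -> V} -> R) : x \notin K ->
  avg (fun b => F (mrg K b0 b)) =
  avg (fun v => avg (fun b => F (mrg (x |: K) (upd b0 x v) b))).
Proof.
move=> xK; rewrite (avg_upd _ x) avg_avg; apply: eq_avg => v.
apply: eq_avg => b; congr F; apply/ffunP=> y; rewrite !ffunE !inE.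
by case: eqVneq => [->|_] //=; rewrite (negPf xK).
Qed.

Lemma mrg0 b0 b : mrg set0 b0 b = b.
Proof. by apply/ffunP=> y; rewrite ffunE inE. Qed.

Lemma mrgE K b0 b y : y \in K -> mrg K b0 b y = b0 y.
Proof. by rewrite ffunE => ->. Qed.

End Resampling.


(** * Simple paths and periodic points of a map *)

Section SimplePaths.
Variable V : finType.
Implicit Types (a : {ffun V -> V}) (K : {set V}).

(** The vertices [x], ..., [a^k x] are distinct and avoid [K]. The visited vertices accumulate in
    [K], so that the recursion evaluates [a] only where it is not yet revealed; [simpleE] gives the
    direct form. *)
Fixpoint simple K a x k :=
  (x \notin K) && (if k is k'.+1 then simple (x |: K) a (a x) k' else true).

Lemma simpleS K a x k : simple K a x k.+1 = (x \notin K) && simple (x |: K) a (a x) k.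
Proof. by []. Qed.

Lemma simpleE K a x k :
  simple K a x k = uniq (traject a x k.+1) && all (fun y => y \notin K) (traject a x k.+1).
Proof.
elim: k K x => [|k IH] K x; first by rewrite /= !andbT.
rewrite simpleS IH [traject a x _]trajectS; set s := traject _ _ _.
have -> : all (fun y => y \notin x |: K) s = (x \notin s) && all (fun y => y \notin K) s.
  rewrite -has_pred1 -all_predC -all_predI; apply: eq_all => y /=.
  by rewrite !inE negb_or.
have -> : uniq (x :: s) = (x \notin s) && uniq s by [].
have -> : all (fun y => y \notin K) (x :: s) = (x \notin K) && all (fun y => y \notin K) s by [].
by case: (x \notin K); case: (uniq s); case: (x \notin s); rewrite /= ?andbF.
Qed.

Lemma simple0E a x k : simple set0 a x k = uniq (traject a x k.+1).
Proof.
rewrite simpleE [X in _ && X](_ : _ = true) ?andbT //.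
by apply/allP => y _; rewrite inE.
Qed.

Lemma simpleN a x k : ~~ simple set0 a x k ->
  exists i j, [/\ (i < j)%N, (j <= k)%N & iter i a x = iter j a x].
Proof.
rewrite simple0E => /(uniqPn x) [i [j [ij]]]; rewrite size_traject ltnS => jk.
rewrite !nth_traject ?ltnS //; last by rewrite (leq_trans (ltnW ij)).
by exists i, j.
Qed.

Lemma simple_neq a x k i j : simple set0 a x k -> (i < j)%N -> (j <= k)%N ->
  iter i a x != iter j a x.
Proof.
rewrite simple0E => /(uniqP x) U ij jk; apply/eqP => E.
have ik : (i <= k)%N by apply: leq_trans (ltnW ij) jk.
have := U i j; rewrite !inE size_traject !ltnS !nth_traject ?ltnS // ik jk.
by move=> /(_ isT isT E) ij'; rewrite ij' ltnn in ij.
Qed.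

(** [x] lies on a cycle of length at most [t]. Stating it through the least period [k + 1] makes its
    probability an instance of [avg_simple0]. *)
Definition periodic a t x := [exists k : 'I_t, simple set0 a x k && (iter k.+1 a x == x)].

Lemma periodicP a t x p : (0 < p <= t)%N -> iter p a x = x -> periodic a t x.
Proof.
move=> pt ap.
have ex : exists p, (0 < p <= t)%N && (iter p a x == x).
  by exists p; rewrite pt ap eqxx.
case: (ex_minnP ex) => {pt ap}[][|k] //= /andP[kt /eqP ak] kmin.
apply/existsP; exists (Ordinal kt); rewrite /= ak eqxx andbT.
apply: contraT => /simpleN[i [j [ij jk E]]].
(* Cutting the repetition out of the cycle gives a smaller period. *)
have H : iter (k.+1 - j + i) a x = x.
  by rewrite iterD E -iterD subnK //; lia.
have := kmin (k.+1 - j + i)%N; rewrite H eqxx andbT; lia.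
Qed.

Lemma iter_periodic a N u : ~~ simple set0 a u N -> periodic a N (iter N a u).
Proof.
move=> /simpleN[i [j [ij jN E]]]; apply: (periodicP (p := j - i)); first lia.
rewrite -iterD (_ : j - i + N = N - i + j)%N; last lia.
by rewrite iterD -E -iterD subnK //; lia.
Qed.

End SimplePaths.

(** * Orbits of a random map: the birthday problem *)

Section BirthdayProblem.
Variables (R : realFieldType) (V : finType).
Implicit Types (a : {ffun V -> V}) (K : {set V}).
Notation n := #|V|.

Definition birthday c k : R := \prod_(i < k) (1 - (c + i.+1)%:R / n%:R).

(** The last vertex of a simple path has not been queried, so its image is uniform and independent
    of the path. The test function [h] of that image lets one induction give both the probability of
    a simple path and that of a cycle closing at [x]. *)
Lemma avg_simple K a0 x k (h : V -> R) : x \notin K ->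
  avg (fun a => (simple K (mrg K a0 a) x k)%:R * h (iter k.+1 (mrg K a0 a) x)) =
  birthday #|K| k * avg h.
Proof.
elim: k K a0 x => [|k IH] K a0 x xK.
  rewrite /birthday big_ord0 mul1r.
  rewrite (avg_mrg a0 (fun a => (simple K a x 0)%:R * h (iter 1 a x)) xK).
  apply: eq_avg => v; rewrite -[RHS](avg_cst _ (_ : 0 < #|{ffun V -> V}|)%N).
    by apply: eq_avg => a /=; rewrite xK mul1r mrgE ?setU11 // upd_same.
  by apply/card_gt0P; exists a0.
rewrite (avg_mrg a0 (fun a => (simple K a x k.+1)%:R * h (iter k.+2 a x)) xK).
rewrite /birthday big_ord_recl addn1 -mulrA.
have cK : #|x |: K| = #|K|.+1 by rewrite cardsU1 xK.
have -> : \prod_(i < k) (1 - (#|K| + (bump 0 i).+1)%:R / n%:R) * avg h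
        = birthday #|x |: K| k * avg h.
  by rewrite cK /birthday; congr (_ * _); apply: eq_bigr => i _; rewrite addSnnS.
have -> : 1 - #|K|.+1%:R / n%:R = avg (fun v => (v \notin x |: K)%:R) :> R.
  have V0 : (0 < n)%N by apply/card_gt0P; exists x.
  rewrite -cK avg_card.
  have -> : #|[pred v | v \notin x |: K]| = #|~: (x |: K)|.
    by apply: eq_card => v; rewrite !inE.
  rewrite [#|~: _|]cardsCs setCK natrB ?max_card // mulrBl divff //.
  by rewrite pnatr_eq0 -lt0n.
rewrite -avgZr; apply: eq_avg => v.
have E a : mrg (x |: K) (upd a0 x v) a x = v by rewrite mrgE ?setU11 // upd_same.
have [vK|vK] := boolP (v \in _); last first.
  rewrite mul1r -(IH _ (upd a0 x v) v vK); apply: eq_avg => a.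
  by rewrite simpleS xK andTb iterSr E.
rewrite mul0r (eq_avg (g := fun _ => 0)).
  by rewrite avg_cst //; apply/card_gt0P; exists a0.
by move=> a; rewrite simpleS xK andTb E; case: k {IH} => [|k] /=; rewrite vK mul0r.
Qed.

Lemma avg_simple0 x k (h : V -> R) :
  avg (fun a : {ffun V -> V} => (simple set0 a x k)%:R * h (iter k.+1 a x)) = birthday 0 k * avg h.
Proof.
rewrite -(cards0 V) -(avg_simple [ffun=> x] k h (x := x)) ?inE //.
by apply: eq_avg => a; rewrite mrg0.
Qed.

Hypothesis V0 : (0 < n)%N.

Let n0 : (0 < n%:R :> R). Proof. by rewrite ltr0n. Qed.

Lemma prob_simple x k : avg (fun a : {ffun V -> V} => (simple set0 a x k)%:R) = birthday 0 k.
Proof.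
have := avg_simple0 x k (fun=> 1); rewrite avg_cst // mulr1 => <-.
by apply: eq_avg => a; rewrite mulr1.
Qed.

(** Factors of the product become negative for indices beyond [n]; reading the product as a
    probability avoids the case distinction. *)
Lemma birthday_ge0 k : 0 <= birthday 0 k.
Proof.
have /card_gt0P[x _] := V0; rewrite -(prob_simple x).
by apply: avg_ge0 => a; rewrite ler0n.
Qed.

Lemma birthday_le1 k : birthday 0 k <= 1.
Proof.
have /card_gt0P[x _] := V0; rewrite -(prob_simple x).
have F0 : (0 < #|{ffun V -> V}|)%N by apply/card_gt0P; exists [ffun=> x].
by rewrite -[leRHS](avg_cst _ F0); apply: le_avg => a; case: simple.
Qed.

Lemma birthdayS k : birthday 0 k.+1 = birthday 0 k * (1 - k.+1%:R / n%:R).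
Proof. by rewrite /birthday big_ord_recr /= add0n. Qed.

Lemma birthday_ge k : 1 - (k ^ 2)%:R / n%:R <= birthday 0 k.
Proof.
elim: k => [|k IH]; first by rewrite /birthday big_ord0 mul0r subr0.
rewrite birthdayS mulrBr mulr1.
have H1 : birthday 0 k * (k.+1%:R / n%:R) <= k.+1%:R / n%:R.
  by rewrite ler_piMl ?birthday_le1 // divr_ge0 ?ler0n.
have : (k.+1 ^ 2)%:R / n%:R = (k ^ 2)%:R / n%:R + (k.*2.+1)%:R / n%:R :> R.
  by rewrite -mulrDl -natrD; congr (_%:R / _); lia.
have : k.+1%:R / n%:R <= (k.*2.+1)%:R / n%:R :> R.
  by rewrite ler_wpM2r ?invr_ge0 ?ler0n // ler_nat; lia.
lra.
Qed.

Lemma birthday_le m j : (m <= n)%N ->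
  birthday 0 (m + j) <= (1 - m%:R / n%:R) ^+ j.
Proof.
move=> mn; elim: j => [|j IH]; first by rewrite addn0 birthday_le1.
have q0 : 0 <= 1 - m%:R / n%:R :> R by rewrite subr_ge0 ler_pdivrMr // mul1r ler_nat.
rewrite addnS birthdayS exprSr.
apply: le_trans (_ : birthday 0 (m + j) * (1 - m%:R / n%:R) <= _); last first.
  by rewrite ler_wpM2r.
rewrite ler_wpM2l ?birthday_ge0 // lerD2l lerN2 ler_wpM2r ?invr_ge0 ?ler0n //.
by rewrite ler_nat; lia.
Qed.

(** The first [m] terms are at most 1, the others are dominated by a geometric series of ratio
    [1 - m / n]. For [m] near the square root of [n] both parts have that order. *)
Lemma sum_birthday_le m t : (0 < m <= n)%N ->
  \sum_(k < t) birthday 0 k <= m%:R + n%:R / m%:R.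
Proof.
move=> /andP[m0 mn].
have m0' : 0 < m%:R :> R by rewrite ltr0n.
set q : R := 1 - m%:R / n%:R.
have q0 : 0 <= q by rewrite subr_ge0 ler_pdivrMr // mul1r ler_nat.
have H j : \sum_(k < j) q ^+ k <= n%:R / m%:R.
  have E : (1 - q) * \sum_(k < j) q ^+ k = 1 - q ^+ j.
    elim: j => [|j IH]; first by rewrite big_ord0 expr0 mulr0 subrr.
    by rewrite big_ord_recr /= mulrDr IH exprS; ring.
  have Q : 0 <= q ^+ j by rewrite exprn_ge0.
  have : (1 - q) * \sum_(k < j) q ^+ k <= 1 by rewrite E; lra.
  have -> : 1 - q = m%:R / n%:R by rewrite /q; ring.
  by rewrite mulrAC ler_pdivrMr // mul1r mulrC -ler_pdivlMr.
apply: le_trans (_ : \sum_(k < m + t) birthday 0 k <= _).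
  rewrite addnC big_split_ord /= lerDl; apply: sumr_ge0 => i _; exact: birthday_ge0.
rewrite big_split_ord /=; apply: lerD.
  rewrite -[m in leRHS]card_ord -sum1_card natr_sum; apply: ler_sum => i _.
  exact: birthday_le1.
apply: le_trans (H t); apply: ler_sum => i _; exact: birthday_le.
Qed.

(** With [h] the indicator of [x], [avg_simple0] shows that the path closes at [x] after [k + 1]
    steps with probability [birthday 0 k / n]; the sum over [x] cancels the [n]. *)
Lemma avg_card_periodic t :
  avg (fun a : {ffun V -> V} => #|[set x | periodic a t x]|%:R) <= \sum_(k < t) birthday 0 k.
Proof.
apply: le_trans (_ : avg (fun a : {ffun V -> V} => \sum_x \sum_(k < t)
   (simple set0 a x k)%:R * (iter k.+1 a x == x)%:R) <= _).
  apply: le_avg => a; rewrite -sum1_card natr_sum big_mkcond /=; apply: ler_sum => x _.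
  rewrite inE; case: ifP => [/existsP[k kP]|_]; last first.
    by apply: sumr_ge0 => k _; rewrite mulr_ge0 ?ler0n.
  rewrite (bigD1 k) //= -natrM mulnb kP lerDl.
  by apply: sumr_ge0 => j _; rewrite mulr_ge0 ?ler0n.
rewrite avg_sum.
have E x : avg (fun a : {ffun V -> V} =>
   \sum_(k < t) (simple set0 a x k)%:R * (iter k.+1 a x == x)%:R) =
   (\sum_(k < t) birthday 0 k) / n%:R.
  rewrite avg_sum mulr_suml; apply: eq_bigr => k _.
  rewrite (avg_simple0 x k (fun y => (y == x)%:R)) avg_card.
  by rewrite (_ : #|_| = 1%N) ?mul1r // -[RHS](card1 x).
rewrite (eq_bigr _ (fun x _ => E x)) sumr_const -[_ *+ _]mulr_natr divfK //.
by rewrite gt_eqF.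
Qed.

(** For a fixed number of steps the bound does not depend on [n]: these exceptional states are few
    and can be treated separately. *)
Lemma avg_card_not_simple k :
  avg (fun a : {ffun V -> V} => #|[set x | ~~ simple set0 a x k]|%:R) <= (k ^ 2)%:R :> R.
Proof.
have E : avg (fun a : {ffun V -> V} => #|[set x | ~~ simple set0 a x k]|%:R) =
   \sum_(x : V) (1 - birthday 0 k) :> R.
  rewrite -(eq_bigr _ (fun x _ => congr1 (fun z => 1 - z) (prob_simple x k))).
  have /card_gt0P[x0 _] := V0.
  have F0 : (0 < #|{ffun V -> V}|)%N by apply/card_gt0P; exists [ffun=> x0].
  rewrite -(eq_bigr _ (fun x _ => congr1 (fun z => z - _) (avg_cst 1 F0))).
  rewrite -(eq_bigr _ (fun x _ => avgB _ _)) -avg_sum; apply: eq_avg => a.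
  rewrite -sum1_card natr_sum big_mkcond; apply: eq_bigr => x _; rewrite inE.
  by case: simple; rewrite /= ?subrr ?subr0.
rewrite E sumr_const -[_ *+ _]mulr_natr -ler_pdivlMr //.
have := birthday_ge k; lra.
Qed.

End BirthdayProblem.


(** * Size of the image of the iterates of a random map *)

Section ImageDecay.
Variables (R : realFieldType) (V : finType).
Implicit Types (a : {ffun V -> V}) (S : {set V}).
Notation n := #|V|.

(** In a fibre of size [N] all elements count if [N >= 2], none if [N = 1]; in both cases at most
    [2 (N - 1)], twice the loss in that fibre. *)
Lemma card_collision (f : V -> V) S :
  (#|[set u in S | f u \in f @: (S :\ u)]| + 2 * #|f @: S| <= 2 * #|S|)%N.
Proof.
have -> : #|[set u in S | f u \in f @: (S :\ u)]| = (\sum_(u in S) (f u \in f @: (S :\ u)))%N.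
  by rewrite -sum1_card big_mkcond [RHS]big_mkcond; apply: eq_bigr => u _; rewrite inE; case: (u \in S); case: (_ \in _).
have E F : (\sum_(u in S) F u = \sum_(v in f @: S) \sum_(u in S | f u == v) F u)%N.
  by rewrite (partition_big_imset f).
have -> : (#|S| = \sum_(u in S) 1)%N by rewrite sum1_card.
have -> : (#|f @: S| = \sum_(v in f @: S) 1)%N by rewrite sum1_card.
rewrite !E 2!big_distrr /= -big_split /=.
apply: leq_sum => v /imsetP[u uS fu].
rewrite sum1dep_card; set A := [set _ | _].
have uA : u \in A by rewrite inE /= uS fu eqxx.
have A0 : (0 < #|A|)%N by apply/card_gt0P; exists u.
have [le1|gt1] := leqP #|A| 1.
  have -> : (\sum_(u in S | f u == v) (f u \in f @: (S :\ u)) = 0)%N; last by lia.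
  apply: big1 => w /andP[wS /eqP fw]; case: imsetP => // -[x]; rewrite !inE => /andP[xw xS] fx.
  have := card_le1_eqP le1 x w; rewrite !inE /= xS wS -fx fw eqxx.
  by move=> /(_ isT isT) E'; rewrite E' eqxx in xw.
have : (\sum_(u in S | f u == v) (f u \in f @: (S :\ u)) <= #|A|)%N; last by lia.
by rewrite -sum1dep_card; apply: leq_sum => w _; case: (_ \in _).
Qed.

(** Cauchy-Schwarz for the sizes of the fibres of [f] on [S], whose sum is [#|S|]. *)
Lemma card_collisions_ge (f : V -> V) S :
  (#|S| ^ 2 <= #|f @: S| * #|[set p : V * V | f p.1 == f p.2]|)%N.
Proof.
pose N v := (\sum_(u in S | f u == v) 1)%N.
pose I := f @: S.
have E F : (\sum_(u in S) F u = \sum_(v in I) \sum_(u in S | f u == v) F u)%N.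
  by rewrite (partition_big f (mem I)) //= => u uS; apply: imset_f.
have sN : (\sum_(v in I) N v = #|S|)%N by rewrite -E sum1_card.
have Y : (\sum_(v in I) N v ^ 2 <= #|[set p : V * V | f p.1 == f p.2]|)%N.
  apply: leq_trans (_ : \sum_(p : V * V | (p.1 \in S) && ((p.2 \in S) && (f p.2 == f p.1))) 1 <= _)%N.
    rewrite -(pair_big_dep (mem S) (fun u w => (w \in S) && (f w == f u)) (fun _ _ => 1%N)) /= E.
    apply: leq_sum => v _; rewrite expnS expn1 {1}/N big_distrl /=.
    by apply: leq_sum => u /andP[_ /eqP <-]; rewrite mul1n.
  rewrite -sum1_card big_mkcond [leqRHS]big_mkcond; apply: leq_sum => p _; rewrite inE.
  by case: (p.1 \in S) => //=; case: (p.2 \in S) => //=; rewrite eq_sym.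
apply: leq_trans (_ : #|f @: S| * \sum_(v in I) N v ^ 2 <= _)%N; last by rewrite leq_mul2l Y orbT.
rewrite -{1}sN -(leq_pmul2l (isT : 0 < 2)%N).
have -> : (2 * (\sum_(v in I) N v) ^ 2 = \sum_(v in I) \sum_(w in I) 2 * (N v * N w))%N.
  rewrite expnS expn1 big_distrl big_distrr /=; apply: eq_bigr => v _.
  by rewrite big_distrr big_distrr.
have -> : (2 * (#|I| * \sum_(v in I) N v ^ 2) =
    \sum_(v in I) \sum_(w in I) (N v ^ 2 + N w ^ 2))%N.
  under [RHS]eq_bigr do rewrite big_split /= sum_nat_const.
  by rewrite big_split /= -big_distrr /= sum_nat_const mul2n addnn.
by apply: leq_sum => v _; apply: leq_sum => w _; exact: (leq_of_leqif (nat_Cauchy _ _)).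
Qed.

Definition image_iter a t := [set iter t a z | z in [set: V]].

Lemma image_iterS a t : image_iter a t.+1 = a @: image_iter a t.
Proof. by rewrite /image_iter -imset_comp; apply: eq_imset => z. Qed.

Lemma card_image_iterS a t : (#|image_iter a t.+1| <= #|image_iter a t|)%N.
Proof. by rewrite image_iterS leq_imset_card. Qed.

(** Only the states at which [a] is evaluated must differ from [u]: the end point [x] may be [u]
    itself. *)
Definition image_avoiding a t u :=
  [set x | [exists z, (iter t a z == x) && [forall i : 'I_t, iter i a z != u]]].

Lemma image_avoiding_sub a a' t u : (forall y, y != u -> a y = a' y) ->
  image_avoiding a t u \subset image_avoiding a' t u.
Proof.
move=> aa'; apply/subsetP => x; rewrite !inE => /existsP[z /andP[/eqP zx /forallP Az]].
have E i : (i <= t)%N -> iter i a' z = iter i a z.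
  elim: i => //= i IH it; rewrite IH ?(ltnW it) // aa' //.
  exact: (Az (Ordinal it)).
apply/existsP; exists z; rewrite E // zx eqxx; apply/forallP => i.
by rewrite E 1?ltnW.
Qed.

Lemma image_avoiding_upd a t u v : image_avoiding (upd a u v) t u = image_avoiding a t u.
Proof.
by apply/eqP; rewrite eqEsubset; apply/andP; split; apply: image_avoiding_sub => y yu;
  rewrite upd_other.
Qed.

Lemma image_avoiding_imset_upd a t u v :
  upd a u v @: (image_avoiding a t u :\ u) = a @: (image_avoiding a t u :\ u).
Proof. by apply: eq_in_imset => y; rewrite !inE => /andP[yu _]; rewrite upd_other. Qed.

(** A point of the image of [a^(t+1)] that is missed by the avoiding paths has [u] on its path,
    hence is one of the [t + 1] states [a u], ..., [a^(t+1) u]. The state [u] itself, if in the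
    image of [a^t], is reached by an avoiding path unless it is periodic, and then the trivial bound
    [n] is used. *)
Lemma image_iter_avoiding a t u :
  ((u \in image_iter a t) * #|image_iter a t.+1| <=
   (u \in image_avoiding a t u) * #|a @: (image_avoiding a t u :\ u)| + t.+1
   + periodic a t u * n)%N.
Proof.
have [/imsetP[z _ uz]|] := boolP (u \in _); rewrite ?mul0n // mul1n.
have [_|Np] := boolP (periodic _ _ _); first by rewrite mul1n (leq_trans (max_card _)) ?leq_addl.
have -> : u \in image_avoiding a t u.
  rewrite inE; apply/existsP; exists z; rewrite -uz eqxx; apply/forallP => i.
  apply: contra Np => /eqP iu; apply: (periodicP (p := t - i)).
    by have := ltn_ord i; lia.
  by rewrite -{1}iu -iterD subnK // ltnW.
rewrite mul1n mul0n addn0.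
pose O := [set iter (nat_of_ord k).+1 a u | k in [set: 'I_t.+1]].
apply: leq_trans (_ : #|a @: (image_avoiding a t u :\ u) :|: O| <= _)%N; last first.
  apply: leq_trans (leq_of_leqif (leq_card_setU _ _)) _; rewrite leq_add2l.
  by apply: leq_trans (leq_imset_card _ _) _; rewrite cardsT card_ord.
apply: subset_leq_card; apply/subsetP => x /imsetP[y _ ->].
have [/existsP[i /eqP iu]|Ne] := boolP [exists i : 'I_t.+1, iter i a y == u].
  rewrite inE; apply/orP; right; apply/imsetP.
  exists (rev_ord i); rewrite ?inE // -iu -iterD.
  by rewrite (_ : (rev_ord i).+1 + i = t.+1)%N //=; have := ltn_ord i; lia.
rewrite inE iterS imset_f // !inE.
move/existsPn: Ne => Ne; rewrite (Ne ord_max) /=; apply/existsP; exists y.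
by rewrite eqxx; apply/forallP => i; apply: (Ne (widen_ord (leqnSn t) i)).
Qed.

Hypothesis V0 : (0 < n)%N.
Let n0 : (0 < n%:R :> R). Proof. by rewrite ltr0n. Qed.
Let F0 : (0 < #|{ffun V -> V}|)%N.
Proof. by have /card_gt0P[x0 _] := V0; apply/card_gt0P; exists [ffun=> x0]. Qed.

Definition mean_image t : R := avg (fun a : {ffun V -> V} => #|image_iter a t|%:R).

(* An u in the image of a^t whose successor a u already lies in the image of the
   other elements is a loss at the next step. The set [image_avoiding a t u] does
   not depend on the value a u, which can therefore be resampled. *)
Lemma mean_image_step t :
  mean_image t.+1 ^+ 2 / n%:R - (2 * t + 1)%:R <= 2 * (mean_image t - mean_image t.+1).
Proof.
pose C a u : R := (u \in image_avoiding a t u)%:R * #|a @: (image_avoiding a t u :\ u)|%:R.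
pose H a u := (u \in image_avoiding a t u) && (a u \in a @: (image_avoiding a t u :\ u)).
have avgH u : avg (fun a => (H a u)%:R) = avg (fun a => C a u / n%:R).
  rewrite (avg_upd _ u); apply: eq_avg => a.
  rewrite /C -mulrA -avg_card -avgZ; apply: eq_avg => v.
  rewrite /H image_avoiding_upd image_avoiding_imset_upd upd_same.
  by rewrite -natrM mulnb.
have Hle a : \sum_u (H a u)%:R <= 2 * (#|image_iter a t|%:R - #|image_iter a t.+1|%:R) :> R.
  have := card_collision a (image_iter a t); rewrite -image_iterS => le1.
  rewrite mulrBr lerBrDr -natr_sum -!natrM -natrD ler_nat; apply: leq_trans le1.
  rewrite leq_add2r -sum1_card [leqRHS]big_mkcond /=.
  have sub : image_avoiding a t _ \subset image_iter a t.
    move=> u; apply/subsetP => x; rewrite inE => /existsP[z /andP[/eqP <- _]].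
    by rewrite imset_f ?inE.
  apply: leq_sum => u _; rewrite inE /H; case: andP => // -[uX auX].
  rewrite (subsetP (sub u)) //= (subsetP _ _ auX) // imsetS // setSD //.
(* Summing [image_iter_avoiding] over [u] and dividing by [n], the orbits of the [u] cost [t + 1]
   and the periodic states at most [t] on average; [sqr_avg_le] handles the main term. *)
have key : (mean_image t.+1 ^+ 2) / n%:R - t.+1%:R - t%:R <=
    \sum_u avg (fun a => (H a u)%:R).
  rewrite (eq_bigr _ (fun u _ => avgH u)) -avg_sum.
  have Per : avg (fun a : {ffun V -> V} => #|[set x | periodic a t x]|%:R) <= t%:R :> R.
    apply: le_trans (avg_card_periodic _ V0 t) _.
    rewrite -[t in leRHS]card_ord -sum1_card natr_sum; apply: ler_sum => k _.
    exact: birthday_le1.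
  apply: le_trans (_ : avg (fun a : {ffun V -> V} => #|image_iter a t.+1|%:R ^+ 2 / n%:R
     - t.+1%:R - #|[set x | periodic a t x]|%:R) <= _).
    rewrite !avgB avgZr avg_cst // lerB // lerD2r ler_wpM2r ?invr_ge0 ?ler0n //.
    exact: sqr_avg_le.
  apply: le_avg => a; rewrite -mulr_suml lerBlDr lerBlDr.
  rewrite ler_pdivrMr // !mulrDl divfK ?gt_eqF //.
  apply: le_trans (_ : (#|image_iter a t| * #|image_iter a t.+1|)%:R <= _).
    by rewrite natrM expr2 ler_wpM2r ?ler0n // ler_nat card_image_iterS.
  rewrite -natrM -[t.+1]/(t.+1) -!natrM.
  have -> : \sum_u C a u = (\sum_u (u \in image_avoiding a t u) * #|a @: (image_avoiding a t u :\ u)|)%N%:R.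
    by rewrite natr_sum; apply: eq_bigr => u _; rewrite /C natrM.
  rewrite -!natrD ler_nat -[X in (X * _ <= _)%N]sum1_card big_distrl /= big_mkcond /=.
  have -> : (t.+1 * n = \sum_(u : V) t.+1)%N by rewrite sum_nat_const mulnC.
  have -> : (#|[set x | periodic a t x]| * n = \sum_u periodic a t u * n)%N.
    rewrite -sum1_card big_distrl /= big_mkcond /=; apply: eq_bigr => u _.
    by rewrite inE; case: periodic.
  rewrite -!big_split /=; apply: leq_sum => u _.
  by rewrite addnAC; have := image_iter_avoiding a t u; case: (u \in image_iter a t); rewrite ?mul0n ?mul1n ?muln1.
apply: le_trans (_ : \sum_u avg (fun a => (H a u)%:R) <= _).
  by apply: le_trans key; rewrite mulnC natrD natrM -[t.+1%:R]natr1; lra.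
rewrite -avg_sum /mean_image -avgB -avgZ; exact: le_avg.
Qed.

(** The recursion is a discrete form of [y' = - y^2 / (2 n)], whose solutions decay like [2 n / t].
    The constant 5 leaves room for the error [2 t + 1], which is of order at most [n / t^2] as long
    as [t^3 <= 2 n]. *)
Lemma mean_image_le t : (0 < t)%N -> (t ^ 3 <= 2 * n)%N ->
  mean_image t <= 5 * n%:R / t%:R.
Proof.
elim: t => // -[|t] IH _ H.
  have : mean_image 1 <= n%:R.
    rewrite -(avg_cst n%:R F0); apply: le_avg => a; rewrite ler_nat; exact: max_card.
  by rewrite divr1; move: n0; lra.
have {}IH : mean_image t.+1 <= 5 * n%:R / t.+1%:R.
  by apply: IH => //; apply: leq_trans H; rewrite leq_exp2r.
have := mean_image_step t.+1; set y := mean_image t.+2; set e := mean_image t.+1 in IH *.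
move=> St; rewrite leNgt; apply/negP => By.
have tn : (t.+2%:R) ^+ 3 <= 2 * n%:R :> R by rewrite -natrX -natrM ler_nat.
set u : R := t.+1%:R; have tE : t.+2%:R = u + 1 :> R by rewrite natr1.
have u1 : 1 <= u by rewrite ler1n.
have tE2 : (2 * t.+1 + 1)%:R = 2 * u + 1 :> R by rewrite natrD natrM.
rewrite tE -/u in IH By tn St *; rewrite tE2 in St.
have u0 : 0 < u by lra.
have v0 : 0 < u + 1 by lra.
(* with y > 5 n / (u + 1), the terms 2 y + y ^ 2 / n exceed 10 n / u + 2 u + 1 *)
have B1 : 5 * n%:R < y * (u + 1) by rewrite -ltr_pdivrMr.
have B2 : e * u <= 5 * n%:R by rewrite -ler_pdivlMr.
have y0 : 0 < y by apply: le_lt_trans By; rewrite divr_ge0 ?mulr_ge0 ?ler0n // ltW.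
have N0 := n0; set N : R := n%:R in N0 tn By B1 B2 St *.
have St' : y ^+ 2 <= (2 * (e - y) + (2 * u + 1)) * N.
  by rewrite -ler_pdivrMr //; lra.
have S2 : y ^+ 2 * (u * (u + 1) ^+ 2) <= (2 * (e - y) + (2 * u + 1)) * N * (u * (u + 1) ^+ 2).
  by rewrite ler_wpM2r // mulr_ge0 ?sqr_ge0 // ltW.
set z := y * (u + 1) in B1.
have zE : y ^+ 2 * (u * (u + 1) ^+ 2) = z ^+ 2 * u by rewrite /z; ring.
have RE : (2 * (e - y) + (2 * u + 1)) * N * (u * (u + 1) ^+ 2) =
   2 * (e * u) * N * (u + 1) ^+ 2 - 2 * z * N * u * (u + 1) + (2 * u + 1) * (u * (u + 1) ^+ 2) * N.
  by rewrite /z; ring.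
have I1 : 2 * (e * u) * N * (u + 1) ^+ 2 <= 2 * (5 * N) * N * (u + 1) ^+ 2.
  by rewrite ler_wpM2r ?sqr_ge0 // ler_wpM2r ?ler_wpM2l // ltW.
have I2 : (2 * u + 1) * (u * (u + 1) ^+ 2) * N <= 2 * (2 * N) * u * N.
  apply: ler_wpM2r; first exact: ltW.
  have -> : (2 * u + 1) * (u * (u + 1) ^+ 2) = ((2 * u + 1) * (u + 1) ^+ 2) * u by ring.
  apply: ler_wpM2r; first exact: ltW.
  apply: le_trans (_ : 2 * (u + 1) ^+ 3 <= _); last lra.
  have -> : 2 * (u + 1) ^+ 3 = (2 * u + 2) * (u + 1) ^+ 2 by ring.
  by rewrite ler_wpM2r ?sqr_ge0 //; lra.
have I3 : 5 * N * (5 * N) * u < z ^+ 2 * u.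
  by rewrite ltr_pM2r // expr2 ltr_pM ?mulr_ge0 // ltW.
have I4 : 2 * (5 * N) * N * u * (u + 1) < 2 * z * N * u * (u + 1).
  by rewrite !ltr_pM2r // ltr_pM2l.
have NN : 0 < N * N by rewrite mulr_gt0.
have Nu : 0 < N * N * u by rewrite mulr_gt0.
have NNu : N * N <= N * N * u by rewrite ler_peMr // ltW.
rewrite zE RE in S2.
have E1 : 2 * (5 * N) * N * (u + 1) ^+ 2 - 2 * (5 * N) * N * u * (u + 1) = 10 * (N * N * u) + 10 * (N * N) by ring.
have E2 : 5 * N * (5 * N) * u = 25 * (N * N * u) by ring.
have E3 : 2 * (2 * N) * u * N = 4 * (N * N * u) by ring.
lra.
Qed.

(* A small image forces many collisions, by Cauchy-Schwarz: a first moment bound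
   on the image replaces a variance bound on the number of collisions. *)
Lemma prob_few_collisions t (s : nat) : (0 < t)%N -> (t ^ 3 <= 2 * n)%N -> (0 < s)%N ->
  avg (fun a : {ffun V -> V} =>
    (5 * s * #|[set p : V * V | iter t a p.1 == iter t a p.2]| < n * t)%N%:R)
  <= s%:R^-1 :> R.
Proof.
move=> t0 tn s0.
have t0' : 0 < t%:R :> R by rewrite ltr0n.
have s0' : 0 < s%:R :> R by rewrite ltr0n.
pose c : R := 5 * s%:R * n%:R / t%:R.
have c0 : 0 < c by rewrite !mulr_gt0 ?invr_gt0.
apply: le_trans (_ : avg (fun a : {ffun V -> V} => (c < #|image_iter a t|%:R)%R%:R) <= _).
  apply: le_avg => a; case: ltnP => [H|_]; last by rewrite ler0n.
  suff -> : c < #|image_iter a t|%:R by [].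
  rewrite ltNge; apply/negP => le1.
  have := card_collisions_ge (iter t a) [set: V]; rewrite cardsT; set Y := #|[set p | _]| in H *.
  rewrite -(ler_nat R) natrM natrX -/(image_iter a t) => le2.
  have le3 : n%:R ^+ 2 <= c * Y%:R by apply: le_trans le2 _; rewrite ler_wpM2r ?ler0n.
  have : n%:R ^+ 2 * t%:R <= 5 * s%:R * Y%:R * n%:R :> R.
    apply: le_trans (_ : c * Y%:R * t%:R <= _); first by rewrite ler_wpM2r ?ler0n.
    by rewrite /c mulrAC divfK ?gt_eqF //; lra.
  have : 5 * s%:R * Y%:R * n%:R < n%:R * t%:R * n%:R :> R by rewrite ltr_pM2r // -!natrM ltr_nat.
  by rewrite expr2; lra.
apply: le_trans (avg_markov c0 _) _; first by move=> a; rewrite ler0n.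
rewrite ler_pdivrMr //; apply: le_trans (mean_image_le t0 tn) _.
rewrite (_ : _ * c = 5 * n%:R / t%:R) // /c; field.
by rewrite !gt_eqF.
Qed.

Lemma avg_card_equal_pairs :
  avg (fun a : {ffun V -> V} => #|[set p : V * V | a p.1 == a p.2]|%:R) <= 2 * n%:R :> R.
Proof.
have -> : avg (fun a : {ffun V -> V} => #|[set p : V * V | a p.1 == a p.2]|%:R) =
   \sum_u \sum_v avg (fun a : {ffun V -> V} => (a u == a v)%:R) :> R.
  under [RHS]eq_bigr => u _ do rewrite -avg_sum.
  rewrite -avg_sum; apply: eq_avg => a; rewrite pair_big /= -natr_sum; congr (_%:R).
  by rewrite -sum1_card big_mkcond; apply: eq_bigr => p _; rewrite inE; case: eqP.
have E u v : avg (fun a : {ffun V -> V} => (a u == a v)%:R) <= (u == v)%:R + n%:R^-1 :> R.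
  have [->|uv] := eqVneq u v.
    under eq_avg do rewrite eqxx; rewrite avg_cst // lerDl invr_ge0 ler0n //.
  rewrite add0r (avg_upd _ u) -[leRHS](avg_cst _ F0); apply: le_avg => a.
  rewrite (eq_avg (g := fun w => (w == a v)%:R)).
    by rewrite avg_card (_ : #|_| = 1%N) ?mul1r // -[RHS](card1 (a v)).
  by move=> w; rewrite upd_same upd_other // eq_sym.
apply: le_trans (_ : \sum_(u : V) \sum_(v : V) ((u == v)%:R + n%:R^-1) <= _).
  by apply: ler_sum => u _; apply: ler_sum => v _.
have S u : \sum_(v : V) ((u == v)%:R + n%:R^-1) = 2 :> R.
  rewrite big_split /= (bigD1 u) //= eqxx big1 => [|v /negPf]; last by rewrite eq_sym => ->.
  by rewrite sumr_const -[n%:R^-1 *+ _]mulr_natr mulVf ?gt_eqF // addr0.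
rewrite (eq_bigr _ (fun u _ => S u)) sumr_const -[_ *+ _]mulr_natr //.
Qed.

End ImageDecay.


(** * Exploring the second map along a binary tree of words *)

Section Exploration.
Variables (R : realFieldType) (V : finType) (a : V -> V) (T : nat).
Implicit Types (b : {ffun V -> V}) (K S : {set V}) (L : seq (V * V)).
Notation n := #|V|.

(* The number of words b (a?) b (a?) ... b a^T, with k optional letters a, that
   merge P and Q. *)
Fixpoint mergings b k P Q : nat :=
  if k is k'.+1 then mergings b k' (b P) (b Q) + mergings b k' (a (b P)) (a (b Q))
  else (iter T a (b P) == iter T a (b Q)).

Definition total b k L : nat := \sum_(p <- L) mergings b k p.1 p.2.

Fixpoint endpoints L : seq V :=
  if L is p :: L' then p.1 :: p.2 :: endpoints L' else [::].

Lemma size_endpoints L : size (endpoints L) = (2 * size L)%N.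
Proof. by elim: L => //= p L ->; lia. Qed.

Definition fresh K (s : seq V) := uniq s && all (fun v => v \notin K) s.

Lemma fresh_cons K v s : fresh K (v :: s) -> v \notin K /\ fresh (v |: K) s.
Proof.
rewrite /fresh /= => /andP[/andP[vs us] /andP[vK sK]]; split=> //; rewrite us /=.
apply/allP => w ws; rewrite !inE negb_or (allP sK) // andbT.
by apply: contraNneq vs => <-.
Qed.

Lemma fresh_cat K s1 s2 : uniq s1 -> all (fun v => v \notin K :|: [set x in s2]) s1 ->
  fresh K s2 -> fresh K (s1 ++ s2).
Proof.
move=> u1 a1 /andP[u2 a2]; rewrite /fresh cat_uniq u1 u2 all_cat a2 !andbT /=.
apply/andP; split; last by apply: sub_all a1 => v; rewrite inE negb_or => /andP[].
apply/hasPn => v vs2; apply/negP => /= /(allP a1).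
by rewrite !inE vs2 orbT.
Qed.

Lemma fresh_perm K s1 s2 : perm_eq s1 s2 -> fresh K s1 = fresh K s2.
Proof. by move=> p; rewrite /fresh (perm_uniq p) (perm_all _ p). Qed.

(** Here [p] and [q] are the answers [b P] and [b Q]; the child pairs are [(p, q)] and [(a p, a q)],
    and all four endpoints must be new. *)
Definition good S p q :=
  uniq [:: p; q; a p; a q] && all (fun v => v \notin S) [:: p; q; a p; a q].

Definition bad_prob S : R := avg (fun p => avg (fun q => (~~ good S p q)%:R)).

Definition hit_prob : R := avg (fun p => avg (fun q => (iter T a p == iter T a q)%:R)).

(** With [k] levels to go, [c k] bounds the number of pairs, [eta k] the probability of a bad answer
    and [G k] the mean of [2 ^ -mergings] for one pair. In [GS] a bad answer counts with weight 1,
    and a good one yields two fresh pairs, hence the square. *)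
Variables (c : nat -> nat) (eta G : nat -> R) (D : nat).
Hypothesis cS : forall k, (k < D)%N -> c k = (2 * c k.+1)%N.
Hypothesis bad_le : forall k S, (0 < k <= D)%N -> (#|S| <= 8 * c k)%N -> bad_prob S <= eta k.
Hypothesis G_ge0 : forall k, 0 <= G k.
Hypothesis G_le1 : forall k, G k <= 1.
Hypothesis G0 : 1 - hit_prob / 2 <= G 0.
Hypothesis GS : forall k, (k < D)%N -> eta k.+1 + (1 - eta k.+1) * G k ^+ 2 <= G k.+1.

Let h : R := 2^-1.
Let h_ge0 : 0 <= h. Proof. by rewrite invr_ge0. Qed.
Let h_le1 : h <= 1. Proof. by rewrite /h; lra. Qed.

Let avg_mrg2 K b0 P Q (F : {ffun V -> V} -> R) : P \notin K -> Q \notin P |: K ->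
  avg (fun b => F (mrg K b0 b)) = avg (fun p => avg (fun q => avg (fun b =>
    F (mrg (Q |: (P |: K)) (upd (upd b0 P p) Q q) b)))).
Proof.
move=> PK QK; rewrite (avg_mrg b0 F PK); apply: eq_avg => p.
by rewrite (avg_mrg _ F QK).
Qed.

Let mrg2P K b0 P Q p q b : Q \notin P |: K ->
  mrg (Q |: (P |: K)) (upd (upd b0 P p) Q q) b P = p.
Proof.
rewrite !inE negb_or => /andP[QP _].
by rewrite mrgE ?inE ?eqxx ?orbT // upd_other ?upd_same // eq_sym.
Qed.

Let mrg2Q K b0 P Q p q b : mrg (Q |: (P |: K)) (upd (upd b0 P p) Q q) b Q = q.
Proof. by rewrite mrgE ?inE ?eqxx // upd_same. Qed.

Let avg2_le (f : V -> V -> R) g : (forall p q, f p q <= g p q) ->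
  avg (fun p => avg (f p)) <= avg (fun p => avg (g p)).
Proof. by move=> fg; apply: le_avg => p; apply: le_avg => q. Qed.

(** A leaf pair receives two independent uniform answers, so it is merged with probability
    [hit_prob], and the mean of [h] to the power of that indicator is [1 - hit_prob / 2]. *)
Lemma explore_leaves L K b0 : fresh K (endpoints L) ->
  avg (fun b => h ^+ total (mrg K b0 b) 0 L) <= G 0 ^+ size L.
Proof.
elim: L K b0 => [|[P Q] L IH] K b0.
  move=> _; rewrite expr0 (eq_avg (g := fun _ => 1)).
    by rewrite avg_cst //; apply/card_gt0P; exists b0.
  by move=> b; rewrite /total big_nil.
move=> /= /fresh_cons[PK /fresh_cons[QK fr]].
rewrite (avg_mrg2 b0 (fun b => h ^+ total b 0 ((P, Q) :: L)) PK QK).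
have V0 : (0 < n)%N by apply/card_gt0P; exists P.
apply: le_trans (_ : avg (fun p => avg (fun q =>
   (1 + (- h) * (iter T a p == iter T a q)%:R) * G 0 ^+ size L)) <= _).
  apply: avg2_le => p q.
  have -> : 1 + (- h) * (iter T a p == iter T a q)%:R = h ^+ (iter T a p == iter T a q).
    by case: (_ == _); rewrite ?expr1 ?expr0 /= ?mulr0 ?addr0 // /h; lra.
  apply: le_trans (_ : h ^+ (iter T a p == iter T a q) *
    avg (fun b => h ^+ total (mrg (Q |: (P |: K)) (upd (upd b0 P p) Q q) b) 0 L) <= _).
    rewrite -avgZ; apply: le_avg => b; rewrite /total big_cons exprD /=.
    by rewrite mrg2P // mrg2Q.
  by rewrite ler_wpM2l ?exprn_ge0 // IH.
have -> : avg (fun p => avg (fun q =>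
   (1 + (- h) * (iter T a p == iter T a q)%:R) * G 0 ^+ size L)) =
   (1 - hit_prob / 2) * G 0 ^+ size L.
  under eq_avg => p do rewrite avgZr avgD avgZ avg_cst //.
  rewrite avgZr avgD avg_cst // avgZ /hit_prob /h.
  by rewrite mulNr [2^-1 * _]mulrC.
by rewrite exprS ler_wpM2r ?exprn_ge0.
Qed.

(* Breadth-first exploration of b: the pairs in L have one more level to go than
   those in L', b is known on K exactly, and all pending endpoints are distinct
   and outside K. Querying a pair of L adds two vertices to K and, if the answer
   is good, two pairs to L'; so both size bounds persist, and at the end of a
   level they give the bounds of the next one, where c doubles. Keeping levels
   together is what makes the loss near the root small. *)
Lemma explore_level k : (k < D)%N ->
  (forall L K b0, (size L <= c k)%N -> (#|K| + 6 * size L <= 8 * c k)%N ->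
     fresh K (endpoints L) ->
     avg (fun b => h ^+ total (mrg K b0 b) k L) <= G k ^+ size L) ->
  forall L L' K b0, (2 * size L + size L' <= 2 * c k.+1)%N ->
    (#|K| + 6 * size L + 2 * size L' <= 8 * c k.+1)%N ->
    fresh K (endpoints L ++ endpoints L') ->
    avg (fun b => h ^+ (total (mrg K b0 b) k.+1 L + total (mrg K b0 b) k L'))
      <= G k.+1 ^+ size L * G k ^+ size L'.
Proof.
(* A good answer adds 2 to [#|K|] and trades one pair of [L] for two of [L'], which leaves both
   weighted sums unchanged. Once [L] is empty, [size L' <= c k] and [#|K| + 2 * size L' <= 4 * c k]
   give the bound [8 * c k] required by the next level. *)
move=> kD IHk; have ck := cS kD.
elim=> [|[P Q] L IH] L' K b0 c1 c2.
  move=> /= fr; rewrite expr0 mul1r.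
  under eq_avg => b do rewrite {1}/total big_nil add0n.
  apply: IHk => //; rewrite ck /= in c1 c2 *; move: c1 c2; clear; lia.
rewrite /= in c1 c2 * => fr0.
have [PK fr1] := fresh_cons fr0; have [QK fr] := fresh_cons fr1.
have V0 : (0 < n)%N by apply/card_gt0P; exists P.
rewrite (avg_mrg2 b0 (fun b => h ^+ (total b k.+1 ((P, Q) :: L) + total b k L')) PK QK).
pose S := K :|: [set x in [:: P, Q & endpoints L ++ endpoints L']].
pose C := G k.+1 ^+ size L * G k ^+ size L'.
have C0 : 0 <= C by rewrite mulr_ge0 ?exprn_ge0.
set K' := Q |: (P |: K).
have cK' : (#|K'| <= #|K| + 2)%N.
  rewrite /K' !cardsU1; case: (_ \notin _); case: (_ \notin _); move: #|K|; clear; lia.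
apply: le_trans (_ : avg (fun p => avg (fun q =>
   ((~~ good S p q)%:R * (1 - G k ^+ 2) + G k ^+ 2) * C)) <= _).
  apply: avg2_le => p q; set b1 := upd _ _ _.
  have bP b : mrg K' b1 b P = p by rewrite mrg2P.
  have bQ b : mrg K' b1 b Q = q by rewrite mrg2Q.
  have tot b : total (mrg K' b1 b) k.+1 ((P, Q) :: L) =
      (total (mrg K' b1 b) k [:: (p, q); (a p, a q)] + total (mrg K' b1 b) k.+1 L)%N.
    by rewrite /total !big_cons big_nil /= bP bQ addn0.
  (* After a bad answer the pair is dropped, its weight being at most 1, and only the two queried
     vertices are added to the known set. *)
  have [gd|_] := boolP (good S p q); last first.
    have i1 : (2 * size L + size L' <= 2 * c k.+1)%N by move: c1; clear; lia.
    have i2 : (#|K'| + 6 * size L + 2 * size L' <= 8 * c k.+1)%N by move: c2 cK'; clear; lia.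
    rewrite mul1r subrK mul1r; apply: le_trans (IH L' K' b1 i1 i2 fr).
    apply: le_avg => b; rewrite tot -addnA exprD ler_piMl ?exprn_ge0 //.
    exact: exprn_ile1.
  rewrite mul0r add0r; apply: le_trans (_ : G k.+1 ^+ size L * G k ^+ (size L').+2 <= _).
    have i1 : (2 * size L + (size L').+2 <= 2 * c k.+1)%N by move: c1; clear; lia.
    have i2 : (#|K'| + 6 * size L + 2 * (size L').+2 <= 8 * c k.+1)%N by move: c2 cK'; clear; lia.
    apply: le_trans (IH [:: (p, q), (a p, a q) & L'] K' b1 i1 i2 _); last first.
      have pe : perm_eq ([:: p; q; a p; a q] ++ (endpoints L ++ endpoints L'))
          (endpoints L ++ [:: p, q, a p, a q & endpoints L']).
        by rewrite perm_catCA.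
      rewrite -(fresh_perm _ pe).
      have /andP[u4 a4] := gd; apply: fresh_cat => //.
      apply: sub_all a4 => v; rewrite !inE !negb_or => /and4P[-> -> ->].
      by rewrite mem_cat negb_or => /andP[-> ->].
    apply: le_avg => b; rewrite tot /total !big_cons big_nil /= addn0.
    have E m1 m2 s s' : (m1 + m2 + s + s' = s + (m1 + (m2 + s')))%N by clear; lia.
    by rewrite E.
  by rewrite -[(size L').+2]addn2 exprD /C; lra.
have -> : avg (fun p => avg (fun q =>
   ((~~ good S p q)%:R * (1 - G k ^+ 2) + G k ^+ 2) * C)) =
   (bad_prob S * (1 - G k ^+ 2) + G k ^+ 2) * C.
  under eq_avg => p do rewrite avgZr avgD avgZr avg_cst //.
  by rewrite avgZr avgD avg_cst // avgZr.
have -> : G k.+1 ^+ size ((P, Q) :: L) * G k ^+ size L' = G k.+1 * C.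
  by rewrite exprS -mulrA.
rewrite ler_wpM2r // (le_trans _ (GS kD)) //.
have : bad_prob S <= eta k.+1.
  apply: bad_le => //; apply: leq_trans (leq_of_leqif (leq_card_setU _ _)) _.
  rewrite cardsE; apply: leq_trans (leq_add (leqnn _) (card_size _)) _.
  by rewrite /= size_cat !size_endpoints; move: c2; clear; lia.
have : G k ^+ 2 <= 1 by apply: exprn_ile1.
move=> g1 be; have : bad_prob S * (1 - G k ^+ 2) <= eta k.+1 * (1 - G k ^+ 2).
  by rewrite ler_wpM2r // subr_ge0.
lra.
Qed.

Lemma explore k : (k <= D)%N -> forall L K b0,
  (size L <= c k)%N -> (#|K| + 6 * size L <= 8 * c k)%N -> fresh K (endpoints L) ->
  avg (fun b => h ^+ total (mrg K b0 b) k L) <= G k ^+ size L.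
Proof.
elim: k => [|k IH] kD L K b0 c1 c2 fr; first exact: explore_leaves.
have := @explore_level k kD (IH (ltnW kD)) L [::] K b0.
rewrite /= cats0 expr0 mulr1 addn0 muln0 addn0 leq_pmul2l // => /(_ c1 c2 fr).
apply: le_trans.
by apply: le_avg => b; rewrite {3}/total big_nil addn0.
Qed.

(** Exponential Markov inequality: on the event in question [2 ^ m * h ^ total] is at least 1. *)
Lemma prob_few_mergings L m : (size L <= c D)%N -> (6 * size L <= 8 * c D)%N ->
  uniq (endpoints L) ->
  avg (fun b => (total b D L < m)%N%:R) <= 2 ^+ m * G D ^+ size L.
Proof.
move=> c1 c2 uL.
have fr : fresh set0 (endpoints L).
  by rewrite /fresh uL; apply/allP => v; rewrite inE.
have H b0 := @explore D (leqnn D) L set0 b0 c1.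
rewrite cards0 add0n in H.
case: (pickP (fun _ : {ffun V -> V} => true)) => [b0 _|none]; last first.
  rewrite /avg big1 ?mul0r ?mulr_ge0 ?exprn_ge0 // => b; by have := none b.
apply: le_trans (_ : avg (fun b => 2 ^+ m * h ^+ total (mrg set0 b0 b) D L) <= _).
  apply: le_avg => b; rewrite mrg0; case: ltnP => [lt|_]; last by rewrite mulr_ge0 ?exprn_ge0.
  rewrite -(subnK (ltnW lt)) exprD -mulrA -exprMn.
  rewrite (_ : 2 * h = 1) ?expr1n ?mulr1 ?exprn_ege1 ?ler1n // /h; lra.
by rewrite avgZ ler_wpM2l ?exprn_ge0 // H.
Qed.

End Exploration.


(** * Solving the recursion for the failure bound *)

Section FailureRecursion.
Variables (R : realFieldType) (k2 : nat).

(** With [k] levels to go the explored set has order [2 ^ (D - k)], and its preimage under [a] makes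
    a bad answer as likely as order [2 ^ (- k / 2)]. The ratio [3 / 4] is slightly above
    [2 ^ (- 1 / 2)], and the losses are summable. *)
Definition loss k : R := (3 / 4) ^+ k / 16.

(* [failure k] bounds the mean of 2^-X, where X is the number of words of the
   binary tree of depth k that merge a given pair; at the leaves, a pair is
   merged with probability at least 8 / 2 ^ k2. *)
Fixpoint failure k : R :=
  if k is k'.+1 then loss k + (1 - loss k) * failure k' ^+ 2 else 1 - 4 / 2 ^+ k2.

Hypothesis k2_ge : (2 <= k2)%N.

Lemma loss_ge0 k : 0 <= loss k.
Proof. by apply: mulr_ge0; [apply: exprn_ge0; lra | lra]. Qed.

Lemma loss_le k : loss k <= 16^-1.
Proof. by rewrite /loss ler_piMl ?invr_ge0 // exprn_ile1 //; lra. Qed.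

Lemma loss_mono j k : (j <= k)%N -> loss k <= loss j.
Proof.
move=> jk; rewrite /loss ler_wpM2r ?invr_ge0 //.
by rewrite -(subnK jk) exprD ler_piMl ?exprn_ge0 ?exprn_ile1 //; lra.
Qed.

Lemma failure_ge0_le1 k : 0 <= failure k <= 1.
Proof.
elim: k => [|k /andP[IH0 IH1]] /=.
  have p : 4 <= 2 ^+ k2 :> R.
    by rewrite -(subnK k2_ge) exprD (_ : 2 ^+ 2 = 4 :> R) ?ler_peMl ?exprn_ege1 //; lra.
  have p0 : 0 < 2 ^+ k2 :> R by lra.
  have : 4 / 2 ^+ k2 <= 1 :> R by rewrite ler_pdivrMr // mul1r.
  have : 0 <= 4 / 2 ^+ k2 :> R by rewrite divr_ge0 // ltW.
  lra.
have l0 := loss_ge0 k.+1; have l1 := loss_le k.+1.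
have f1 : failure k ^+ 2 <= 1 by apply: exprn_ile1.
have f0 : 0 <= failure k ^+ 2 by apply: sqr_ge0.
apply/andP; split; first by rewrite addr_ge0 // mulr_ge0 //; lra.
have : (1 - loss k.+1) * failure k ^+ 2 <= (1 - loss k.+1) * 1.
  by rewrite ler_wpM2l //; lra.
lra.
Qed.

(* If g = 1 / (1 + z), then squaring g at least doubles z. *)
Lemma failure_step (e z g : R) : 0 <= e -> 0 <= z -> e * (5 + 2 * z) <= 1 ->
  0 <= g -> g * (1 + z) <= 1 -> (e + (1 - e) * g ^+ 2) * (1 + 2 * (1 - e) * z) <= 1.
Proof.
move=> e0 z0 ez g0 gz.
have ez0 : 0 <= e * z by rewrite mulr_ge0.
have e1 : e <= 1 by lra.
have z1 : 0 < (1 + z) ^+ 2 by rewrite exprn_gt0 //; lra.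
have G2 : g ^+ 2 * (1 + z) ^+ 2 <= 1.
  by rewrite -exprMn exprn_ile1 // mulr_ge0 //; lra.
rewrite -(ler_pM2r z1) mul1r.
have -> : (e + (1 - e) * g ^+ 2) * (1 + 2 * (1 - e) * z) * (1 + z) ^+ 2 =
   (e * (1 + z) ^+ 2 + (1 - e) * (g ^+ 2 * (1 + z) ^+ 2)) * (1 + 2 * (1 - e) * z) by ring.
have w0 : 0 <= 1 + 2 * (1 - e) * z by rewrite addr_ge0 ?mulr_ge0 //; lra.
apply: le_trans (_ : (e * (1 + z) ^+ 2 + (1 - e) * 1) * (1 + 2 * (1 - e) * z) <= _).
  by rewrite ler_wpM2r // lerD2l ler_wpM2l //; lra.
(* The terms of degree 0 and 1 in [z] cancel; what remains is [z ^ 2] times a factor that the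
   assumption on [e * (5 + 2 * z)] makes nonnegative. *)
rewrite -subr_ge0.
have -> : (1 + z) ^+ 2 - (e * (1 + z) ^+ 2 + (1 - e) * 1) * (1 + 2 * (1 - e) * z) =
  z ^+ 2 * (1 - e * (5 + 2 * z) + 2 * e ^+ 2 * (2 + z)) by ring.
rewrite mulr_ge0 ?sqr_ge0 // addr_ge0 ?subr_ge0 // mulr_ge0 //; last lra.
by rewrite mulr_ge0 ?sqr_ge0.
Qed.

Let sum_loss k : \sum_(i < k) loss i.+1 <= 3 / 16.
Proof.
have -> : \sum_(i < k) loss i.+1 = 3 / 16 - 3 / 16 * (3 / 4) ^+ k.
  elim: k => [|k IH]; first by rewrite big_ord0 expr0; lra.
  by rewrite big_ord_recr /= IH /loss exprS; lra.
have : 0 <= (3 / 4) ^+ k :> R by rewrite exprn_ge0 //; lra.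
lra.
Qed.

(** In the form [failure k <= 1 / (1 + z)], each level multiplies [z] by [2 (1 - loss)], starting
    from [4 / 2 ^ k2]; the product of the factors [1 - loss] is replaced by 1 minus their sum. At
    level [k2], [z] is at least [13 / 4]. *)
Let failure_growth k : (k <= k2)%N ->
  failure k * (1 + 2 ^+ k * (1 - \sum_(i < k) loss i.+1) * (4 / 2 ^+ k2)) <= 1.
Proof.
have t0 : 0 < 4 / 2 ^+ k2 :> R by rewrite divr_gt0 ?exprn_gt0.
elim: k => [|k IH] kk.
  rewrite /= expr0 big_ord0 subr0 !mul1r.
  have := sqr_ge0 (4 / 2 ^+ k2 : R); lra.
have {}IH := IH (ltnW kk).
set z := 2 ^+ k * _ * _ in IH; have s3 := sum_loss k.
have sk0 : 0 <= \sum_(i < k) loss i.+1 by apply: sumr_ge0 => i _; exact: loss_ge0.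
have pk : 0 < 2 ^+ k :> R by rewrite exprn_gt0.
have z0 : 0 <= z by rewrite /z !mulr_ge0 //; lra.
have z2 : z <= 2.
  apply: le_trans (_ : 2 ^+ k * 1 * (4 / 2 ^+ k2) <= _).
    by rewrite /z ler_wpM2r ?ler_wpM2l //; lra.
  rewrite mulr1 mulrA ler_pdivrMr ?exprn_gt0 //.
  have -> : 2 * 2 ^+ k2 = 4 * (2 ^+ (k2 - k.+1) * 2 ^+ k) :> R.
    by rewrite -{1}(subnK kk) exprD exprS; ring.
  rewrite mulrC ler_wpM2l // ler_peMl ?exprn_ege1; lra.
have l0 := loss_ge0 k.+1; have l1 := loss_le k.+1.
have /andP[f0 _] := failure_ge0_le1 k.
have := failure_step l0 z0 _ f0 IH; rewrite [failure k.+1]/=.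
move=> H; have {}H : (loss k.+1 + (1 - loss k.+1) * failure k ^+ 2) * (1 + 2 * (1 - loss k.+1) * z) <= 1.
  apply: H; apply: le_trans (_ : 16^-1 * (5 + 2 * 2) <= _); last lra.
  apply: ler_pM => //; lra.
apply: le_trans H; rewrite ler_wpM2l //.
  by have /andP[] := failure_ge0_le1 k.+1.
rewrite lerD2l big_ord_recr /= exprS /z.
set S := \sum_(i < k) _ in sk0 *; set t := 4 / _ in t0 *.
have -> : 2 * (1 - loss k.+1) * (2 ^+ k * (1 - S) * t) =
   2 * 2 ^+ k * (1 - (S + loss k.+1)) * t + 2 * 2 ^+ k * (S * loss k.+1) * t by ring.
by rewrite lerDl; apply: mulr_ge0; [apply: mulr_ge0; [lra | exact: mulr_ge0] | exact: ltW].
Qed.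

Let failure_quarter : failure k2 <= 4^-1.
Proof.
have := failure_growth (leqnn k2); have := sum_loss k2; set S := \sum_(_ < _) _.
have p : 2 ^+ k2 != 0 :> R by rewrite expf_neq0 // pnatr_eq0.
have -> : 2 ^+ k2 * (1 - S) * (4 / 2 ^+ k2) = (1 - S) * 4 by field.
have /andP[f0 _] := failure_ge0_le1 k2 => s3.
have : failure k2 * 4 <= failure k2 * (1 + (1 - S) * 4) by rewrite ler_wpM2l //; lra.
lra.
Qed.

(** Once below [1 / 4] the bound is squared at each level, down to a floor set by the losses. For
    [g <= 1 / 4] and [l <= 1 / 16] one has [(g + 4 l) ^ 2 + l <= g ^ 2 + 4 l]. *)
Lemma failure_squaring i :
  failure (k2 + i) <= 4^-1 ^+ (2 ^ i) + 4 * loss k2.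
Proof.
elim: i => [|i IH].
  by rewrite addn0 expn0 expr1; have := failure_quarter; have := loss_ge0 k2; lra.
rewrite addnS [failure _.+1]/=; set g := 4^-1 ^+ _ in IH.
have -> : 4^-1 ^+ (2 ^ i.+1) = g ^+ 2 :> R by rewrite expnS mulnC exprM.
have l0 := loss_ge0 k2; have l1 := loss_le k2.
have /andP[f0 f1] := failure_ge0_le1 (k2 + i).
have lm : loss (k2 + i).+1 <= loss k2 by apply: loss_mono; lia.
have l0' := loss_ge0 (k2 + i).+1.
have g0 : 0 <= g by rewrite exprn_ge0 // invr_ge0.
have g4 : g <= 4^-1.
  rewrite /g -{2}[4^-1]expr1; apply: ler_wiXn2l; [lra|lra|].
  by rewrite expn_gt0.
have f2 : failure (k2 + i) ^+ 2 <= (g + 4 * loss k2) ^+ 2 by rewrite ler_pXn2r // nnegrE; lra.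
have s0 : 0 <= failure (k2 + i) ^+ 2 by apply: sqr_ge0.
have : (1 - loss (k2 + i).+1) * failure (k2 + i) ^+ 2 <= 1 * failure (k2 + i) ^+ 2.
  by rewrite ler_wpM2r //; lra.
have : g * loss k2 <= 4^-1 * loss k2 by rewrite ler_wpM2r.
have : loss k2 * loss k2 <= 16^-1 * loss k2 by rewrite ler_wpM2r.
move: f2; rewrite sqrrD !expr2; lra.
Qed.

Lemma failure_le D : (k2 <= D)%N -> (k2 < 2 ^ (D - k2))%N -> failure D <= (3 / 4) ^+ k2.
Proof.
move=> kD k2D; have := failure_squaring (D - k2); rewrite subnKC //.
have : 4^-1 ^+ (2 ^ (D - k2)) <= 3 / 4 * (3 / 4) ^+ k2 :> R.
  rewrite -exprS; apply: le_trans (_ : 4^-1 ^+ k2.+1 <= _).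
    by apply: ler_wiXn2l => //; lra.
  by apply: lerXn2r; rewrite ?nnegrE; lra.
rewrite /loss; lra.
Qed.

End FailureRecursion.


(* Here x = (3 / 4) ^ k and p = 2 ^ k: as p >= 1 / x ^ 2, both the linear term r
   and the term w, of order sqrt r, are small compared with n * x. *)
Lemma bad_answers_estimate (R : realFieldType) (x p M w r s n : R) :
  0 <= x -> 1 <= x * p -> 1 <= x ^+ 2 * p -> 1 <= p -> 1 <= M -> 0 < n -> 1 <= s ->
  600 * (600 * (s * (M * p))) <= n -> r <= 80 * M -> w ^+ 2 <= r * (s * n) -> 0 <= w ->
  2 * r + 2 * w + 3 + 3 * s <= x / 16 * n.
Proof.
move=> x0 xp xp2 p1 M1 n0 s1 nM rM wR w0.
have sM : s * M <= n * x / 600 / 600.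
  have h1 : s * M <= s * M * (x * p) by rewrite ler_peMr // mulr_ge0; lra.
  have h2 : 600 * (600 * (s * (M * p))) * x <= n * x by rewrite ler_wpM2r.
  have e : 600 * (600 * (s * (M * p))) * x = 600 * (600 * (s * M * (x * p))) by ring.
  lra.
have MsM : M <= s * M by rewrite ler_peMl //; lra.
have ssM : s <= s * M by rewrite ler_peMr //; lra.
have wx : w <= n * x / 64.
  have : w ^+ 2 <= (n * x / 64) ^+ 2.
    apply: le_trans wR _.
    have h1 : r * (s * n) <= 80 * M * (s * n) by rewrite ler_wpM2r // mulr_ge0; lra.
    have h2 : s * M <= s * M * (x ^+ 2 * p) by rewrite ler_peMr // mulr_ge0; lra.
    have h3 : 600 * (600 * (s * (M * p))) * x ^+ 2 <= n * x ^+ 2 by rewrite ler_wpM2r ?sqr_ge0.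
    have e : 600 * (600 * (s * (M * p))) * x ^+ 2 = 600 * (600 * (s * M * (x ^+ 2 * p))) by ring.
    have h4 : s * M * n <= n * x ^+ 2 / 600 / 600 * n by rewrite ler_pM2r //; lra.
    have e2 : (n * x / 64) ^+ 2 = n * x ^+ 2 * n / 4096 by field.
    have e3 : 80 * M * (s * n) = 80 * (s * M * n) by ring.
    have h5 : 0 <= n * x ^+ 2 * n by rewrite !mulr_ge0 ?sqr_ge0 // ltW.
    have e4 : n * x ^+ 2 / 600 / 600 * n = n * x ^+ 2 * n / 600 / 600 by ring.
    lra.
  rewrite ler_pXn2r // nnegrE; apply: mulr_ge0; last lra.
  by apply: mulr_ge0 => //; lra.
have nx0 : 0 <= n * x by apply: mulr_ge0 => //; lra.
lra.
Qed.

(** * Probability of a bad answer *)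

Section BadAnswers.
Variables (R : realFieldType) (V : finType) (a : V -> V) (s D : nat).
Implicit Types (S : {set V}).
Notation n := #|V|.
Hypothesis V0 : (0 < n)%N.
Hypothesis s0 : (0 < s)%N.
Hypothesis collisions_le : (#|[set p : V * V | a p.1 == a p.2]| <= s * n)%N.
Hypothesis fixed_le : (#|[set x | a x == x]| <= s)%N.
Hypothesis D_le : (600 * (600 * (s * 2 ^ D)) <= n)%N.

(** Union bound: [p], [q], [a p] or [a q] lies in [S]; three coincidences [p = q], [p = a q],
    [q = a p] of probability [1 / n] each; a fixed point [p] or [q], or a collision [a p = a q], at
    most [s / n] each. *)
Lemma bad_prob_bound S : bad_prob R a S * n%:R <= (2 * #|S| + 2 * #|a @^-1: S| + 3 + 3 * s)%:R.
Proof.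
have n0 : 0 < n%:R :> R by rewrite ltr0n.
pose m (P : V -> V -> bool) : R := avg (fun p => avg (fun q => (P p q)%:R)).
pose t1 p q := m (fun x y => p x y) + m (fun x y => q x y).
have swap P : m P = m (fun p q => P q p) by rewrite /m avg_avg.
have m1 (A : {set V}) : m (fun p q => p \in A) = #|A|%:R / n%:R.
  transitivity (avg (fun x => (x \in A)%:R) : R); last by rewrite avg_card.
  by apply: eq_avg => p; rewrite avg_cst.
have me (f : V -> V) : m (fun p q => p == f q) = n%:R^-1.
  rewrite swap /m -[RHS](avg_cst _ V0); apply: eq_avg => q.
  exact: avg_eq_op.
have mf : m (fun p q => a p == p) <= s%:R / n%:R.
  rewrite /m (eq_avg (g := fun p => (p \in [set x | a x == x])%:R)); last first.
    by move=> p; rewrite inE avg_cst.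
  by rewrite avg_card ler_wpM2r ?invr_ge0 ?ler_nat ?ltW.
have mc : m (fun p q => a p == a q) <= s%:R / n%:R.
  rewrite /m -(avg_pair (fun z : V * V => (a z.1 == a z.2)%:R)) avg_card card_prod natrM.
  have -> : #|[pred z : V * V | a z.1 == a z.2]| = #|[set p : V * V | a p.1 == a p.2]|.
    by apply: eq_card => z; rewrite !inE.
  rewrite ler_pdivrMr ?mulr_gt0 // mulrA divfK ?gt_eqF //.
  by rewrite -natrM ler_nat.
have B : bad_prob R a S <=
  m (fun p q => p \in S) + m (fun p q => q \in S) +
  m (fun p q => p \in a @^-1: S) + m (fun p q => q \in a @^-1: S) +
  m (fun p q => p == q) + m (fun p q => p == a q) + m (fun p q => q == a p) +
  m (fun p q => a p == p) + m (fun p q => a q == q) + m (fun p q => a p == a q).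
  rewrite /m -!avgD; apply: le_avg => p; rewrite -!avgD; apply: le_avg => q.
  rewrite -!natrD ler_nat; case gd: (good a S p q) => //=.
  rewrite lt0n; apply: contraFneq gd => /eqP; rewrite !addn_eq0 !eqb0 !inE.
  case/andP=> /andP[/andP[/andP[/andP[/andP[/andP[/andP[/andP[h1 h2] h3] h4] h5] h6] h7] h8] h9] h10.
  by rewrite /good /= !inE !negb_or h1 h2 h3 h4 h5 h6 h7 h10 [p == a p]eq_sym [q == a q]eq_sym h8 h9.
rewrite (swap (fun p q => q \in S)) (swap (fun p q => q \in a @^-1: S))
  (swap (fun p q => q == a p)) (swap (fun p q => a q == q)) !m1 (me id) (me a) in B.
have {}B : bad_prob R a S <= (2 * #|S| + 2 * #|a @^-1: S| + 3 + 3 * s)%:R / n%:R.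
  apply: le_trans B _; rewrite 3!natrD 3!natrM; lra.
by rewrite -ler_pdivlMr.
Qed.

Lemma card_preim_sqr S : (#|a @^-1: S| ^ 2 <= #|S| * (s * n))%N.
Proof.
apply: leq_trans (card_collisions_ge a _) _; apply: leq_mul => //.
by apply: subset_leq_card; apply/subsetP => x /imsetP[y]; rewrite inE => ? ->.
Qed.

Lemma bad_prob_le_loss k S : (k <= D)%N -> (#|S| <= 8 * (10 * 2 ^ (D - k)))%N ->
  bad_prob R a S <= loss R k.
Proof.
move=> kD cS.
have n0 : 0 < n%:R :> R by rewrite ltr0n.
rewrite -(ler_pM2r n0); apply: le_trans (bad_prob_bound S) _.
have := card_preim_sqr S; set w := #|a @^-1: S|; set r := #|S| in cS *; move=> wr.
rewrite /loss; set x : R := (3 / 4) ^+ k.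
pose M : R := (2 ^ (D - k))%:R; pose p : R := 2 ^+ k.
have sr : 1 <= s%:R :> R by rewrite ler1n.
have M1 : 1 <= M by rewrite ler1n expn_gt0.
have p1 : 1 <= p by rewrite exprn_ege1 // ler1n.
have nM : 600 * (600 * (s%:R * (M * p))) <= n%:R.
  have -> : M * p = (2 ^ D)%:R by rewrite /M /p -natrX -natrM -expnD subnK.
  by rewrite -!natrM ler_nat.
have rM : r%:R <= 80 * M by rewrite /M -natrM ler_nat mulnA in cS *.
have wR : w%:R ^+ 2 <= r%:R * (s%:R * n%:R) :> R by rewrite -natrX -!natrM ler_nat.
rewrite 3!natrD 3!natrM.
have xp : 1 <= x * p.
  by rewrite /x /p -exprMn exprn_ege1 //; lra.
have xp2 : 1 <= x ^+ 2 * p.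
  by rewrite /x /p -exprM mulnC exprM -exprMn exprn_ege1 //; lra.
have x0 : 0 <= x by rewrite exprn_ge0 //; lra.
exact: (bad_answers_estimate x0 xp xp2 p1 M1 n0 sr nM rM wR (ler0n R w)).
Qed.

End BadAnswers.

(* Near the root a pair of queries fails with probability of order n^-1/2 only, so
   a union bound over all pairs of states needs several fresh starts per pair. *)
Section DistinctShifts.
Variables (V : finType) (f g : nat -> V) (m : nat).
Hypothesis f_inj : {in gtn m &, injective f}.
Hypothesis g_inj : {in gtn m &, injective g}.
Hypothesis fg : forall j, (j < m)%N -> f j != g j.

Let pairs (js : seq nat) := endpoints [seq (f j, g j) | j <- js].

(** Greedy choice: [k] chosen pairs contain [2 k] states, each excluding at most one shift through
    [f] and one through [g], hence at most [4 k] shifts altogether. *)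
Lemma distinct_shifts k : (4 * k < m + 4)%N ->
  exists js, [/\ size js = k, uniq (pairs js) & all (gtn m) js].
Proof.
elim: k => [|k IH] km; first by exists [::].
have [js [sj uj aj]] := IH (ltac:(lia)).
have [/hasP[j]|/hasPn all_bad] := boolP (has (fun j => (f j \notin pairs js) && (g j \notin pairs js)) (iota 0 m)).
  rewrite mem_iota /= add0n => jm /andP[fj gj].
  exists (j :: js); rewrite /= sj aj jm -/(pairs js) uj gj !andbT; split => //.
  by rewrite inE negb_or fg.
have cnt (h : nat -> V) : {in gtn m &, injective h} ->
    (count (fun j => h j \in pairs js) (iota 0 m) <= 2 * k)%N.
  move=> h_inj; rewrite -size_filter -(size_map h).
  rewrite -sj -[size js](size_map (fun j => (f j, g j))) -size_endpoints.
  apply: uniq_leq_size.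
    rewrite map_inj_in_uniq ?filter_uniq ?iota_uniq // => i j.
    rewrite !mem_filter !mem_iota /= !add0n => /andP[_ im] /andP[_ jm]; exact: h_inj.
  by move=> v /mapP[j]; rewrite mem_filter => /andP[? _] ->.
have := count_predUI (fun j => f j \in pairs js) (fun j => g j \in pairs js) (iota 0 m).
have -> : count (predU (fun j => f j \in pairs js) (fun j => g j \in pairs js)) (iota 0 m) = m.
  apply/eqP; rewrite -[X in _ == X](size_iota 0 m) -all_count; apply/allP => j jm /=.
  by have := all_bad j jm; rewrite negb_and !negbK.
have := cnt f f_inj; have := cnt g g_inj; lia.
Qed.

End DistinctShifts.


(** * Every pair of states is merged by many words *)

Section AllPairsMerge.
Variables (R : realFieldType) (V : finType) (a : {ffun V -> V}) (s q D T k2 : nat).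
Implicit Types (b : {ffun V -> V}).
Notation n := #|V|.

Lemma mergings_same b k P : mergings a T b k P P = (2 ^ k)%N.
Proof. by elim: k P => [|k IH] P /=; rewrite ?eqxx // !IH addnn -mul2n expnS. Qed.

Definition mergings_of_pair b x y : nat :=
  (\sum_(j < q.+1) mergings a T b D (iter j a x) (iter j a y))%N.

Lemma total_le_mergings_of_pair b x y js : uniq js -> all (gtn q.+1) js ->
  (total a T b D [seq (iter j a x, iter j a y) | j <- js] <= mergings_of_pair b x y)%N.
Proof.
move=> ujs ajs; rewrite /total big_map /= /mergings_of_pair -(big_mkord xpredT (fun j => mergings a T b D (iter j a x) (iter j a y))).
rewrite [leqRHS](bigID (fun j => j \in js)) /=.
rewrite (_ : \sum_(j <- js) _ = \sum_(0 <= j < q.+1 | j \in js) mergings a T b D (iter j a x) (iter j a y))%N ?leq_addr //.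
rewrite -[RHS]big_filter; apply: perm_big; apply: uniq_perm => //.
  by rewrite filter_uniq // iota_uniq.
move=> j; rewrite mem_filter mem_index_iota /=; case jjs: (j \in js) => //=.
by have /= -> := allP ajs _ jjs.
Qed.

Hypothesis V0 : (0 < n)%N.
Hypothesis s0 : (0 < s)%N.
Hypothesis collisions_le : (#|[set p : V * V | a p.1 == a p.2]| <= s * n)%N.
Hypothesis fixed_le : (#|[set x | a x == x]| <= s)%N.
Hypothesis D_le : (600 * (600 * (s * 2 ^ D)) <= n)%N.
Hypothesis q_ge : (39 <= q)%N.
Hypothesis k2_ge : (2 <= k2)%N.
Hypothesis k2D : (k2 <= D)%N.
Hypothesis k2_lt : (k2 < 2 ^ (D - k2))%N.
Hypothesis hits : (8 * n ^ 2 <= 2 ^ k2 * #|[set p : V * V | iter T a p.1 == iter T a p.2]|)%N.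

(** Ten disjoint pairs are explored simultaneously, hence the level width [10 * 2 ^ (D - k)] and the
    tenth power. By [hits] a random pair is merged with probability at least [8 / 2 ^ k2], which
    matches the initial value of [failure]. *)
Lemma prob_few_mergings_of_ten L m : size L = 10 -> uniq (endpoints L) ->
  avg (fun b => (total a T b D L < m)%N%:R) <= 2 ^+ m * (3 / 4) ^+ (10 * k2) :> R.
Proof.
move=> sL uL; pose c k := (10 * 2 ^ (D - k))%N.
have hit : 1 - hit_prob R a T / 2 <= failure R k2 0.
  rewrite /= lerD2l lerN2.
  have -> : hit_prob R a T = #|[set p : V * V | iter T a p.1 == iter T a p.2]|%:R / (n ^ 2)%:R.
    rewrite /hit_prob -(avg_pair (fun z : V * V => (iter T a z.1 == iter T a z.2)%:R)).
    by rewrite avg_card card_prod expnS expn1; congr (_%:R / _); apply: eq_card => z; rewrite !inE.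
  have p0 : 0 < 2 ^+ k2 :> R by rewrite exprn_gt0.
  have n0 : 0 < (n ^ 2)%:R :> R by rewrite ltr0n expn_gt0 V0.
  rewrite ler_pdivrMr // mulrAC ler_pdivlMr // mulrAC ler_pdivlMr //.
  move: hits; rewrite -(ler_nat R) !natrM natrX; lra.
have cS k : (k < D)%N -> c k = (2 * c k.+1)%N.
  by move=> kD; rewrite /c (_ : D - k = (D - k.+1).+1)%N ?expnS; move: kD; clear; lia.
have bad k (S : {set V}) : (0 < k <= D)%N -> (#|S| <= 8 * c k)%N -> bad_prob R a S <= loss R k.
  by move=> /andP[_ kD] SS; apply: (bad_prob_le_loss _ V0 s0 collisions_le fixed_le D_le).
have fge k : 0 <= failure R k2 k by have /andP[] := failure_ge0_le1 R k2_ge k.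
have fle k : failure R k2 k <= 1 by have /andP[] := failure_ge0_le1 R k2_ge k.
have GS k : (k < D)%N -> loss R k.+1 + (1 - loss R k.+1) * failure R k2 k ^+ 2 <= failure R k2 k.+1.
  by [].
have := prob_few_mergings cS bad fge fle hit GS m (L := L).
rewrite /c subnn sL => /(_ isT isT uL) H; apply: le_trans H _.
rewrite ler_wpM2l ?exprn_ge0 // mulnC exprM.
by apply: lerXn2r; rewrite ?nnegrE ?exprn_ge0 ?failure_le //; lra.
Qed.

Lemma prob_few_mergings_of_pair x y m : x != y ->
  simple set0 a x q -> simple set0 a y q -> (m <= 2 ^ D)%N ->
  avg (fun b => (mergings_of_pair b x y < m)%N%:R) <= 2 ^+ m * (3 / 4) ^+ (10 * k2) :> R.
Proof.
move=> xy sx sy mD.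
have e0 : 0 <= 2 ^+ m * (3 / 4) ^+ (10 * k2) :> R by rewrite mulr_ge0 // exprn_ge0 //; lra.
have q40 : (4 * 10 < q.+1 + 4)%N by move: q_ge; clear; lia.
(* If the orbits have met after [q] steps, all [2 ^ D] words with prefix [a^q] merge the pair,
   whatever [b] is. Otherwise the iterates differ at every shift up to [q]. *)
have [E|NE] := eqVneq (iter q a x) (iter q a y).
  rewrite (eq_avg (g := fun _ => 0)); first by rewrite avg0.
  move=> b; rewrite ltnNge (_ : (m <= _)%N) // (leq_trans mD) //.
  by rewrite /mergings_of_pair big_ord_recr /= E mergings_same leq_addl.
have inj z : simple set0 a z q -> {in gtn q.+1 &, injective (fun j => iter j a z)}.
  move=> sz i j; rewrite !inE !ltnS => iq jq E.
  have [ij|ji|//] := ltngtP i j.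
    by have := simple_neq sz ij jq; rewrite E eqxx.
  by have := simple_neq sz ji iq; rewrite E eqxx.
have ne j : (j < q.+1)%N -> iter j a x != iter j a y.
  rewrite ltnS => jq; apply: contraNneq NE => E.
  by rewrite -(subnK jq) !iterD E.
have [js [sj uj aj]] := distinct_shifts (inj x sx) (inj y sy) ne q40.
have ujs : uniq js.
  have : uniq [seq (iter j a x, iter j a y) | j <- js].
    move: uj; set L := [seq _ | _ <- _]; elim: L => //= p L IH /and3P[n1 n2 u].
    rewrite IH // andbT; apply: contra n1 => pL; rewrite inE; apply/orP; right.
    elim: L pL {IH n2 u} => //= r L IH; rewrite !inE => /orP[/eqP ->|/IH ->]; rewrite ?eqxx ?orbT //.
  by move/map_uniq.
apply: le_trans (prob_few_mergings_of_ten m _ uj); last by rewrite size_map sj.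
apply: le_avg => b; rewrite ler_nat; case: ltnP => //= lt.
by rewrite (leq_ltn_trans (total_le_mergings_of_pair b x y ujs aj) lt).
Qed.

Lemma prob_all_pairs_merge m : (m <= 2 ^ D)%N ->
  avg (fun b => (~~ [forall x, forall y, [&& x != y, simple set0 a x q & simple set0 a y q] ==>
     (m <= mergings_of_pair b x y)%N])%:R)
  <= (n ^ 2)%:R * (2 ^+ m * (3 / 4) ^+ (10 * k2)) :> R.
Proof.
move=> mD; set e : R := 2 ^+ m * _.
have e0 : 0 <= e by rewrite mulr_ge0 // exprn_ge0 //; lra.
pose B b x y := [&& x != y, simple set0 a x q & simple set0 a y q] && (mergings_of_pair b x y < m)%N.
apply: le_trans (_ : avg (fun b => \sum_x \sum_y (B b x y)%:R) <= _).
  apply: le_avg => b; case: (boolP [forall x, _]) => [_|].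
    by apply: sumr_ge0 => x _; apply: sumr_ge0 => y _.
  rewrite negb_forall => /existsP[x].
  rewrite negb_forall => /existsP[y]; rewrite negb_imply -ltnNge -/(B b x y) => Bxy.
  rewrite (bigD1 x) //= (bigD1 y) //= Bxy -addrA lerDl addr_ge0 //.
    by apply: sumr_ge0 => y' _.
  by apply: sumr_ge0 => x' _; apply: sumr_ge0 => y' _.
rewrite avg_sum (_ : (n ^ 2)%:R * e = \sum_(x : V) \sum_(y : V) e); last first.
  by rewrite !sumr_const -mulrnA -[RHS]mulr_natl expnS expn1.
apply: ler_sum => x _; rewrite avg_sum; apply: ler_sum => y _.
case E : [&& x != y, simple set0 a x q & simple set0 a y q]; last first.
  rewrite (eq_avg (g := fun _ => 0)) => [|b]; last by rewrite /B E.
  by rewrite avg0.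
have /and3P[xy sx sy] := E.
apply: le_trans (prob_few_mergings_of_pair xy sx sy mD); apply: le_avg => b.
by rewrite /B E.
Qed.

End AllPairsMerge.


(** * Leaving a bounded set of exceptional states *)

Section EscapeFromSmallSet.
Variables (R : realFieldType) (V : finType).
Notation n := #|V|.

Lemma avg_apply x (h : V -> R) : avg (fun b : {ffun V -> V} => h (b x)) = avg h.
Proof.
rewrite (avg_upd _ x) avg_avg; apply: eq_avg => v; under eq_avg do rewrite upd_same.
by rewrite avg_cst //; apply/card_gt0P; exists [ffun=> x].
Qed.

Lemma avg_apply2 x y (h h' : V -> R) : x != y ->
  avg (fun b : {ffun V -> V} => h (b x) * h' (b y)) = avg h * avg h'.
Proof.
move=> xy; rewrite (avg_upd _ x) -(avg_apply y h') -avgZ; apply: eq_avg => b.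
by rewrite -avgZr; apply: eq_avg => v; rewrite upd_same upd_other // eq_sym.
Qed.

Variables (S : {set V}) (s : nat).
Hypothesis V0 : (0 < n)%N.
Hypothesis S_le : (#|S| <= s)%N.

Let n0 : 0 < n%:R :> R. Proof. by rewrite ltr0n. Qed.

Let avg_mem : avg (fun v => (v \in S)%:R) <= s%:R / n%:R :> R.
Proof. by rewrite avg_card ler_wpM2r ?invr_ge0 ?ler0n // ler_nat. Qed.

Lemma prob_not_escaping :
  avg (fun b : {ffun V -> V} => [exists x in S, b x \in S]%:R) <= (s ^ 2)%:R / n%:R :> R.
Proof.
apply: le_trans (_ : avg (fun b : {ffun V -> V} => \sum_(x in S) (b x \in S)%:R) <= _).
  apply: le_avg => b; case: existsP => [[x /andP[xS bx]]|_]; last by apply: sumr_ge0.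
  by rewrite (bigD1 x) //= bx lerDl sumr_ge0.
rewrite avg_sum (eq_bigr (fun _ => avg (fun v => (v \in S)%:R))); last first.
  by move=> x _; rewrite (avg_apply x (fun v => (v \in S)%:R)).
rewrite sumr_const -[_ *+ _]mulr_natl expnS expn1 natrM -mulrA.
by apply: ler_pM; rewrite ?ler0n ?ler_nat ?avg_ge0.
Qed.

(** For [a y != y] the two values are independent, so each [y] contributes at most [(s / n) ^ 2].
    Outside this event a state [y] moved by [a] is sent outside [S] by [b] or by [a] followed by
    [b]. *)
Lemma prob_twice_into_set (a : V -> V) :
  avg (fun b : {ffun V -> V} => [exists y, [&& a y != y, b y \in S & b (a y) \in S]]%:R)
    <= (s ^ 2)%:R / n%:R :> R.
Proof.
pose p : R := avg (fun v => (v \in S)%:R).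
apply: le_trans (_ : avg (fun b : {ffun V -> V} =>
    \sum_(y | a y != y) (b y \in S)%:R * (b (a y) \in S)%:R) <= _).
  apply: le_avg => b; case: existsP => [[y /and3P[ay b1 b2]]|_]; last first.
    by apply: sumr_ge0 => y _; rewrite mulr_ge0.
  rewrite (bigD1 y) //= b1 b2 mulr1 lerDl; apply: sumr_ge0 => z _; exact: mulr_ge0.
rewrite avg_sum (eq_bigr (fun _ => p * p)); last first.
  move=> y ay; rewrite (avg_apply2 (fun v => (v \in S)%:R) (fun v => (v \in S)%:R)) //.
  by rewrite eq_sym.
apply: le_trans (_ : \sum_(y : V) p * p <= _).
  by rewrite big_mkcond; apply: ler_sum => y _; case: ifP => // _; rewrite mulr_ge0 ?avg_ge0.
rewrite sumr_const -[_ *+ _]mulr_natr.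
have p0 : 0 <= p by apply: avg_ge0.
apply: le_trans (_ : (s%:R / n%:R) * (s%:R / n%:R) * n%:R <= _).
  by rewrite ler_wpM2r ?ler0n //; apply: ler_pM.
by rewrite expnS expn1 natrM mulrA divfK ?gt_eqF // mulrAC.
Qed.

End EscapeFromSmallSet.

(** * Merged pairs and loss of cardinality *)

Section ShrinkingSets.
Variable V : finType.
Implicit Types (S : {set V}) (f : V -> V).

Definition merged f S := [set p : V * V | [&& p.1 \in S, p.2 \in S, p.1 != p.2 & f p.1 == f p.2]].

(** A fibre of size [N] contains [N (N - 1)] ordered pairs and accounts for a loss of [N - 1], and
    [N] is at most the total loss plus one. *)
Lemma card_merged_le f S :
  (#|merged f S| <= (#|S| - #|f @: S|) * (#|S| - #|f @: S|).+1)%N.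
Proof.
pose N v := (\sum_(u in S | f u == v) 1)%N.
pose I := f @: S.
have E F : (\sum_(u in S) F u = \sum_(v in I) \sum_(u in S | f u == v) F u)%N.
  by rewrite (partition_big f (mem I)) //= => u uS; apply: imset_f.
have N1 v : v \in I -> (0 < N v)%N.
  by move=> /imsetP[u uS ->]; rewrite /N (bigD1 u) //= uS eqxx.
have rE : (#|S| - #|I| = \sum_(v in I) (N v).-1)%N.
  rewrite -[#|S|]sum1_card -[#|I|]sum1_card E.
  rewrite (eq_bigr (fun v => (N v).-1 + 1)%N) => [|v /N1 Nv]; last by rewrite -/(N v) addn1 prednK.
  by rewrite big_split /= addnK.
have XE : (#|merged f S| = \sum_(v in I) N v * (N v).-1)%N.
  rewrite -sum1_card (eq_bigl (fun p : V * V => (p.1 \in S) && [&& p.2 \in S, f p.2 == f p.1 & p.2 != p.1])); last first.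
    by move=> p; rewrite inE [p.2 == p.1]eq_sym [f p.2 == _]eq_sym; case: (p.1 == p.2); rewrite /= ?andbF ?andbT.
  rewrite -(pair_big_dep (mem S) (fun u w => [&& w \in S, f w == f u & w != u]) (fun _ _ => 1%N)) /= E.
  apply: eq_bigr => v _; rewrite [in RHS]/N big_distrl /=.
  apply: eq_bigr => u /andP[uS /eqP fu]; rewrite mul1n /N [in RHS](bigD1 u) ?uS ?fu ?eqxx //=.
  by apply: eq_bigl => w; rewrite andbA.
rewrite rE XE big_distrl /=; apply: leq_sum => v vI.
rewrite mulnC leq_mul2l; apply/orP; right.
by rewrite -(prednK (N1 v vI)) ltnS (bigD1 v) //= leq_addr.
Qed.

(* A set that shrinks by d contains at most d (d + 1) ordered merged pairs, with
   equality when they all lie in one fibre. *)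
Lemma many_merged_shrink f S r : (r * r.-1 < #|merged f S|)%N -> (#|f @: S| + r <= #|S|)%N.
Proof.
move=> lt; have := card_merged_le f S; have := leq_imset_card f S; move: lt.
move: #|S| #|f @: S| #|merged f S| => x y z lt yx le.
have {lt le} lt : (r * r.-1 < (x - y) * (x - y).+1)%N by apply: leq_trans le.
rewrite leqNgt; apply/negP => xr; move: lt; rewrite ltnNge => /negP; apply.
have xyr : ((x - y).+1 <= r)%N by move: xr yx; clear; lia.
rewrite mulnC; apply: leq_mul => //; move: xyr; clear; lia.
Qed.

End ShrinkingSets.


(** * Building a synchronizing word for a fixed automaton *)

Lemma exists_above_average (T : Type) (p : pred T) (X : T -> nat) B (W : seq T) : all p W ->
  (size W * B < \sum_(w <- W) X w)%N -> exists2 w, p w & (B < X w)%N.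
Proof.
elim: W => [|w W IH] /=; first by rewrite big_nil ltn0.
move=> /andP[pw pW]; rewrite big_cons.
have [lt|ge] := ltnP B (X w); first by exists w.
move=> H; apply: IH => //; move: H ge; rewrite mulSn; clear.
by move: (size W * B)%N (\sum_(_ <- _) _)%N (X w) => y z x; lia.
Qed.

Section Words.
Variables (n : nat) (A : automaton n).
Notation a := A.1.
Notation b := A.2.
Notation act := (word_act A).

Lemma word_act_cat w1 w2 u : act (w1 ++ w2) u = act w2 (act w1 u).
Proof. by rewrite /word_act foldl_cat. Qed.

Lemma word_act_nseq j u : act (nseq j La) u = iter j a u.
Proof. by elim: j u => //= j IH u; rewrite -[LHS]/(act (nseq j La) (a u)) IH -iterSr. Qed.

Fixpoint tree_words T k : seq (seq letter) :=
  if k is k'.+1 then map (cons Lb) (tree_words T k') ++ map (cat [:: Lb; La]) (tree_words T k')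
  else [:: Lb :: nseq T La].

Lemma size_tree_words T k : size (tree_words T k) = (2 ^ k)%N.
Proof. by elim: k => //= k IH; rewrite size_cat !size_map IH addnn -mul2n expnS. Qed.

Lemma mergingsE T k P Q :
  mergings a T b k P Q = (\sum_(w <- tree_words T k) (act w P == act w Q))%N.
Proof.
elim: k P Q => [|k IH] P Q /=.
  by rewrite big_seq1 -[act _ P]/(act (nseq T La) (b P)) -[act _ Q]/(act (nseq T La) (b Q)) !word_act_nseq.
by rewrite big_cat !big_map !IH.
Qed.

Lemma tree_words_le T k : all (fun w => size w <= 2 * k + 1 + T)%N (tree_words T k).
Proof.
elim: k => [|k IH] /=; first by rewrite size_nseq; lia.
by rewrite all_cat !all_map; apply/andP; split; apply: sub_all IH => w /=; lia.
Qed.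

Definition merging_words q T D : seq (seq letter) :=
  flatten [seq map (cat (nseq j La)) (tree_words T D) | j <- iota 0 q.+1].

Lemma mergings_of_pairE q T D x y :
  mergings_of_pair a q D T b x y = (\sum_(w <- merging_words q T D) (act w x == act w y))%N.
Proof.
rewrite /mergings_of_pair /merging_words big_flatten big_map -[iota 0 q.+1]/(index_iota 0 q.+1) big_mkord.
apply: eq_bigr => j _; rewrite mergingsE big_map; apply: eq_bigr => w _.
by rewrite !word_act_cat !word_act_nseq.
Qed.

Lemma size_merging_words q T D : size (merging_words q T D) = (q.+1 * 2 ^ D)%N.
Proof.
rewrite /merging_words size_flatten /shape -map_comp.
rewrite (eq_map (g := fun _ => (2 ^ D)%N)) => [|j]; last by rewrite /= size_map size_tree_words.
rewrite sumnE big_map -[iota 0 q.+1]/(index_iota 0 q.+1) sum_nat_const_nat subn0 //.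
Qed.

Lemma merging_words_le q T D :
  all (fun w => size w <= q + (2 * D + 1 + T))%N (merging_words q T D).
Proof.
rewrite /merging_words; have : all (fun j => j <= q)%N (iota 0 q.+1).
  by apply/allP => j; rewrite mem_iota add0n ltnS.
elim: (iota 0 q.+1) => //= j s IH /andP[jq sq]; rewrite all_cat IH // andbT all_map.
apply: sub_all (tree_words_le T D) => w /=; rewrite size_cat size_nseq; move: jq; clear; lia.
Qed.

Lemma imset_act_cat w1 w2 (S : {set 'I_n}) :
  [set act (w1 ++ w2) x | x in S] = [set act w2 x | x in [set act w1 x | x in S]].
Proof. by rewrite -imset_comp; apply: eq_imset => x; rewrite /= word_act_cat. Qed.

(** Every round spends at most [l] letters and removes at least [r] states, so a state costs [l / r]
    letters. It serves twice: with a large [r] down to a threshold, then with [r = 1] down to one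
    state. *)
Lemma iterate_shrinking M r l : (0 < r)%N ->
  (forall S : {set 'I_n}, (M < #|S|)%N ->
     exists2 w, (size w <= l)%N & (#|[set act w x | x in S]| + r <= #|S|)%N) ->
  forall S : {set 'I_n},
     exists2 w, (#|[set act w x | x in S]| <= M)%N & (r * size w <= l * #|S|)%N.
Proof.
move=> r0 step S; have [k] := ubnP #|S|; elim: k S => // k IH S Sk.
have [SM|MS] := leqP #|S| M; first by exists [::]; rewrite ?muln0 // imset_id.
have [w wl wS] := step S MS.
have [|w' w'M w'l] := IH [set act w x | x in S].
  rewrite ltnS in Sk; apply: leq_trans Sk; apply: leq_trans wS.
  by rewrite -addn1 leq_add2l.
exists (w ++ w'); first by rewrite imset_act_cat.
rewrite size_cat mulnDr; apply: leq_trans (_ : l * (#|[set act w x | x in S]| + r) <= _)%N.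
  by rewrite mulnDr addnC leq_add // mulnC leq_mul2r wl orbT.
by rewrite leq_mul2l wS orbT.
Qed.

Variables (q T D m : nat).
Notation short := [set x | ~~ simple set0 a x q].
Notation l := (q + (2 * D + 1 + T))%N.
Hypothesis m0 : (0 < m)%N.
Hypothesis pairs_merge : forall x y, x != y -> simple set0 a x q -> simple set0 a y q ->
  (m <= mergings_of_pair a q D T b x y)%N.
Hypothesis short_escapes : forall x, x \in short -> b x \notin short.
Hypothesis long_stays : forall y, y \notin short -> (b y \notin short) || (b (a y) \notin short).

Let in_short x : (x \in short) = ~~ simple set0 a x q. Proof. by rewrite inE. Qed.

Lemma short_next x : x \in short -> a x \in short.
Proof.
rewrite !in_short => /simpleN[i [j [ij jq E]]]; apply/negP => S.
(* A repetition not involving [x] itself is shifted by one step; if [x] recurs, [a x] lies on the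
   same cycle. *)
case: i ij E => [|i] ij E; last first.
  case: j ij jq E => // j ij jq; rewrite !iterSr => E.
  by have := simple_neq S (ij : (i < j)%N) (ltnW jq); rewrite E eqxx.
have E' : iter j a (a x) = a x by rewrite -iterSr iterS -E.
by have := simple_neq S ij jq; rewrite E' eqxx.
Qed.

Lemma merge_long_pair x y : x != y -> x \notin short -> y \notin short ->
  exists2 w, (size w <= l)%N & act w x = act w y.
Proof.
rewrite !in_short !negbK => xy sx sy; have := pairs_merge xy sx sy; rewrite mergings_of_pairE => H.
have [|w wl] := exists_above_average (B := 0) (X := fun w => nat_of_bool (act w x == act w y)) (merging_words_le q T D).
  by rewrite muln0 (leq_trans m0).
by rewrite lt0b => /eqP E; exists w.
Qed.

(** One of the empty word, [b] and [ab] sends both states outside [short]; the delicate case is a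
    pair with exactly one state in [short]. *)
Lemma merge_pair x y : exists2 w, (size w <= l + 2)%N & act w x = act w y.
Proof.
suff [u u2 uP] : exists2 u, (size u <= 2)%N & act u x \notin short /\ act u y \notin short.
  have [E|NE] := eqVneq (act u x) (act u y).
    by exists u => //; apply: leq_trans u2 _; rewrite leq_addl.
  have [w wl wE] := merge_long_pair NE uP.1 uP.2.
  exists (u ++ w); last by rewrite !word_act_cat.
  by rewrite size_cat addnC leq_add.
wlog xy : x y / (x \in short) || (y \notin short).
  move=> W; case xs: (x \in short); first by apply: W; rewrite xs.
  case ys: (y \in short); last by apply: W; rewrite ys orbT.
  have [|u u2 [u1 u1']] := W y x; first by rewrite ys.
  by exists u.
case xs: (x \in short) xy => /= ys; last by exists [::] => //; split; rewrite ?xs.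
have [ysh|ysh] := boolP (y \in short).
  by exists [:: Lb] => //; split; apply: short_escapes.
have /orP[by1|by2] := long_stays ysh.
  by exists [:: Lb] => //; split => //; apply: short_escapes.
(* The letter [a] keeps [x] in [short], so the following [b] still moves it out. *)
by exists [:: La; Lb] => //; split => //; apply: short_escapes; exact: short_next.
Qed.

Lemma shrink_by_one (S : {set 'I_n}) : (1 < #|S|)%N ->
  exists2 w, (size w <= l + 2)%N & (#|[set act w x | x in S]| + 1 <= #|S|)%N.
Proof.
move=> /card_gt1P[x [y [xS yS xy]]]; have [w wl E] := merge_pair x y.
exists w => //; apply: many_merged_shrink; rewrite mul1n; apply/card_gt0P.
by exists (x, y); rewrite inE /= xS yS xy E eqxx.
Qed.

(** Double count of words and ordered pairs: at least [(M - s) * (M - s).-1] pairs of distinct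
    states of [S] outside [short] are each merged by [m] of the [q.+1 * 2 ^ D] words, so some word
    merges more than [r * r.-1] pairs. *)
Lemma shrink_by_many (S : {set 'I_n}) s r M : (#|short| <= s)%N -> (M < #|S|)%N ->
  (q.+1 * 2 ^ D * (r * r.-1) < m * ((M - s) * (M - s).-1))%N ->
  exists2 w, (size w <= l)%N & (#|[set act w x | x in S]| + r <= #|S|)%N.
Proof.
move=> ss MS H; pose S' := S :\: short.
have S'M : (M - s <= #|S'|)%N.
  have le : (#|S :&: short| <= s)%N by apply: leq_trans ss; apply: subset_leq_card; apply: subsetIr.
  by rewrite leq_subLR (leq_trans (ltnW MS)) // -(cardsID short S) leq_add2r.
have [|w wl wr] := exists_above_average (B := r * r.-1) (X := fun w => #|merged (act w) S|) (merging_words_le q T D); last first.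
  by exists w => //; apply: many_merged_shrink.
rewrite size_merging_words; apply: leq_trans H _.
apply: leq_trans (_ : m * (#|S'| * #|S'|.-1) <= _)%N.
  by rewrite leq_mul2l leq_mul ?orbT //; move: S'M; clear; lia.
have -> : (#|S'| * #|S'|.-1 = \sum_(x in S') \sum_(y in S' :\ x) 1)%N.
  rewrite -sum_nat_const; apply: eq_bigr => x xS.
  by rewrite sum1_card (cardsD1 x S') xS.
rewrite big_distrr /=.
have E w : (#|merged (act w) S| = \sum_x \sum_y [&& x \in S, y \in S, x != y & act w x == act w y])%N.
  rewrite pair_big -sum1_card big_mkcond /=; apply: eq_bigr => p _.
  by rewrite inE; case: [&& _, _, _ & _].
rewrite (eq_bigr _ (fun w _ => E w)) exchange_big /= big_mkcond; apply: leq_sum => x _.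
case: ifP => // xS; rewrite big_distrr exchange_big /= big_mkcond; apply: leq_sum => y _.
case: ifP => //; rewrite !inE => /and3P[yx ysh yS]; move: xS; rewrite !inE => /andP[xsh xS].
rewrite muln1 xS yS eq_sym yx /= -mergings_of_pairE; apply: pairs_merge; first by rewrite eq_sym.
  by rewrite -[simple _ _ _ _]negbK.
by rewrite -[simple _ _ _ _]negbK.
Qed.

(** The length splits into [N] letters [a] to reach the image of [a^N], at most [L] letters to come
    down to [M] states at [l / r] letters per state, and [l + 2] letters for each remaining
    state. *)
Lemma synchronizing_word s r M Z N L : (0 < n)%N -> (0 < r)%N ->
  (#|short| <= s)%N -> (#|image_iter a N| <= Z)%N ->
  (q.+1 * 2 ^ D * (r * r.-1) < m * ((M - s) * (M - s).-1))%N ->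
  (l * Z <= r * L)%N ->
  exists2 w, synchronizing A w & (size w <= N + L + (l + 2) * M)%N.
Proof.
move=> n0 r0 ss imZ HM HL.
have [w1 w1M w1l] := iterate_shrinking r0 (fun S MS => shrink_by_many ss MS HM) (image_iter a N).
have [w2 w2M w2l] := iterate_shrinking (isT : 0 < 1)%N shrink_by_one [set act w1 x | x in image_iter a N].
exists (nseq N La ++ (w1 ++ w2)).
  pose u0 : 'I_n := Ordinal n0.
  exists (act (nseq N La ++ (w1 ++ w2)) u0) => u.
  have := card_le1_eqP w2M; apply; rewrite !word_act_cat !word_act_nseq;
    by do 3 apply: imset_f.
have w1L : (size w1 <= L)%N.
  rewrite -(leq_pmul2l r0); apply: leq_trans w1l _; apply: leq_trans HL.
  by rewrite leq_mul2l imZ orbT.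
rewrite !size_cat size_nseq addnA; apply: leq_add; first by rewrite leq_add2l.
by rewrite mul1n in w2l; apply: leq_trans w2l _; rewrite leq_mul2l w1M orbT.
Qed.

End Words.


(** * Numerical estimates *)

Section Numerics.

Lemma exists_isqrt n : exists m, (m ^ 2 <= n < m.+1 ^ 2)%N.
Proof.
elim: n => [|n [m /andP[mn nm]]]; first by exists 0.
have [lt|ge] := ltnP n.+1 (m.+1 ^ 2); first by exists m; rewrite lt andbT leqW.
exists m.+1; rewrite ge /=; apply: leq_ltn_trans nm _.
by rewrite ltn_exp2r.
Qed.

(** For [j] the integer part of [L / (k + 1)], [2 ^ L >= (2 ^ j) ^ (k + 1) >= (j + 1) ^ (k + 1)];
    one factor [j + 1] absorbs the constants, the others bound [L ^ k]. *)
Lemma poly_le_exp c k : exists L0, forall L, (L0 <= L)%N -> (c * L ^ k <= 2 ^ L)%N.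
Proof.
exists (k.+1 * (c * k.+1 ^ k)).+1%N => L LL.
pose j := (L %/ k.+1)%N.
have jL : (L < k.+1 * j.+1)%N by rewrite mulnC ltn_ceil.
have cj : (c * k.+1 ^ k <= j)%N by rewrite /j leq_divRL // mulnC ltnW.
apply: leq_trans (_ : c * (k.+1 * j.+1) ^ k <= _)%N.
  rewrite leq_mul2l; apply/orP; right.
  have [->|k0] := posnP k; first by rewrite !expn0.
  by rewrite leq_exp2r // ltnW.
apply: leq_trans (_ : j.+1 ^ k.+1 <= _)%N.
  by rewrite expnMn mulnA expnS leq_mul2r (leq_trans cj) ?orbT.
apply: leq_trans (_ : (2 ^ j) ^ k.+1 <= _)%N; first by rewrite leq_exp2r // ltn_expl.
by rewrite -expnM leq_exp2l // leq_trunc_div.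
Qed.

Variable R : realFieldType.

Lemma bernoulli_inv (x : R) k : 0 <= x <= 1 -> (1 - x) ^+ k * (1 + k%:R * x) <= 1.
Proof.
move=> /andP[x0 x1]; elim: k => [|k IH]; first by rewrite expr0 mul0r addr0 mulr1.
apply: le_trans IH; rewrite exprSr -mulrA ler_wpM2l ?exprn_ge0 ?subr_ge0 //.
rewrite -natr1; have : 0 <= k%:R * x * x by rewrite !mulr_ge0.
have := mulr_ge0 x0 x0; lra.
Qed.

(** As [#|V| < (2 m) ^ 2] up to equality, [m / #|V|] is at least [1 / (4 m)], and after the first
    [m] steps every [4 m] further steps halve the bound. The result [4 ^ -lam] allows a sum over
    fewer than [2 ^ (lam + 1)] states. *)
Lemma birthday_tail (V : finType) m lam : (0 < m)%N -> (m ^ 2 <= #|V| < m.+1 ^ 2)%N ->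
  birthday R V 0 (m + 8 * m * lam) <= 4^-1 ^+ lam.
Proof.
move=> m0 /andP[mn nm].
have V0 : (0 < #|V|)%N by apply: leq_trans mn; rewrite expn_gt0 m0.
have mV : (m <= #|V|)%N by apply: leq_trans mn; rewrite expnS expn1 leq_pmulr.
apply: le_trans (birthday_le _ V0 _ mV) _.
have n0 : 0 < #|V|%:R :> R by rewrite ltr0n.
set x : R := _ / _; have x1 : x <= 1 by rewrite ler_pdivrMr // mul1r ler_nat.
have x0 : 0 <= x by rewrite divr_ge0.
have h : (1 - x) ^+ (4 * m) <= 2^-1.
  have x01 : 0 <= x <= 1 by rewrite x0 x1.
  have := bernoulli_inv (4 * m) x01.
  have p0 : 0 <= (1 - x) ^+ (4 * m) by rewrite exprn_ge0 // subr_ge0.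
  have kx : 1 <= (4 * m)%:R * x.
    rewrite /x mulrA ler_pdivlMr // mul1r -natrM ler_nat.
    apply: leq_trans (ltnW nm) _; rewrite (_ : 4 * m * m = (2 * m) ^ 2)%N; last by rewrite expnMn expnS expn1 !mulnA.
    by rewrite leq_exp2r //; move: m0; clear; lia.
  have : (1 - x) ^+ (4 * m) * 1 <= (1 - x) ^+ (4 * m) * ((4 * m)%:R * x) by rewrite ler_wpM2l.
  lra.
have -> : (8 * m * lam = (4 * m) * (2 * lam))%N by lia.
rewrite exprM; apply: le_trans (_ : 2^-1 ^+ (2 * lam) <= _).
  by apply: lerXn2r; rewrite ?nnegrE ?exprn_ge0 ?subr_ge0 ?invr_ge0.
by rewrite exprM (_ : 2^-1 ^+ 2 = 4^-1) // expr2; lra.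
Qed.

(** [(3 / 4) ^ 10 < 1 / 16]: this is what ten starting pairs buy. *)
Lemma failure_tail k : (3 / 4) ^+ (10 * k) <= (2 ^+ (4 * k))^-1 :> R.
Proof.
rewrite !exprM -exprVn; apply: lerXn2r; rewrite ?nnegrE ?invr_ge0 ?exprn_ge0 //; try lra.
Qed.

End Numerics.


(** * Choice of parameters and probability of the good events *)

Section RandomAutomaton.
Variables (R : realFieldType) (n s e m lam q : nat).

(** [c * lam] bounds the length of a merging word plus the two letters of [merge_pair]. With
    [r = s * c], removing [s * m] states costs at most [m * lam] letters. *)
Let c := (160 * s * 2 ^ e + 44)%N.
Let r := (s * c)%N.

Hypothesis s0 : (0 < s)%N.
Hypothesis q39 : q = 39.
Hypothesis m_sqrt : (m ^ 2 <= n < m.+1 ^ 2)%N.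
Hypothesis lam_log : (2 ^ lam <= n < 2 ^ lam.+1)%N.
Hypothesis e_large : (600 * (600 * s) <= 2 ^ e)%N.
Hypothesis lam_gt : (640 * (c ^ 2 * r ^ 2) < lam)%N.
(** These conditions have the shape of [poly_le_exp], which supplies them for large [lam]. *)
Hypothesis exp1 : (2 ^ (e + 3) * lam ^ 1 <= 2 ^ lam)%N.
Hypothesis exp2 : (s * 2 ^ (4 * e + 6) * lam ^ 4 <= 2 ^ lam)%N.
Hypothesis exp3 : ((160 * s * 2 ^ e) ^ 3 * lam ^ 3 <= 2 ^ lam)%N.
Hypothesis exp4 : ((2 * (c * (s + 2)) + 1) ^ 2 * lam ^ 0 <= 2 ^ lam)%N.
Hypothesis exp5 : ((2 * s) ^ 3 * lam ^ 0 <= 2 ^ lam)%N.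

(** [160 = 8 * 5 * 2 * 2]: [8 * n ^ 2 / 2 ^ k2] colliding pairs are required, [n * T / (5 * s)] are
    available, and the factors 2 come from [n < 2 ^ lam.+1] and [2 ^ g <= 2 * lam]. *)
Let T := (160 * s * 2 ^ e * lam)%N.
(** The number of levels reserved for the repeated squaring of [failure], which needs
    [2 ^ g > k2]. *)
Let g := (trunc_log 2 lam).+1.
Let D := (lam - e)%N.
Let k2 := (D - g)%N.
Let N := (m + 8 * m * lam)%N.

Let lam0 : (0 < lam)%N. Proof. exact: leq_ltn_trans lam_gt. Qed.
Let n0 : (0 < n)%N.
Proof. by have /andP[le _] := lam_log; apply: leq_trans le; rewrite expn_gt0. Qed.

Let g_gt : (lam < 2 ^ g)%N.
Proof. by have /andP[] := trunc_log_bounds (isT : 1 < 2)%N lam0. Qed.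

Let g_le : (2 ^ g <= 2 * lam)%N.
Proof. by have /andP[] := trunc_log_bounds (isT : 1 < 2)%N lam0; rewrite /g expnS leq_mul2l. Qed.

Let eg_lam : (e + 2 + g <= lam)%N.
Proof.
rewrite -(leq_exp2l (m := 2)) //; apply: leq_trans exp1; rewrite !expnD expn1.
apply: leq_trans (_ : 2 ^ e * 2 ^ 2 * (2 * lam) <= _)%N; first by rewrite leq_mul2l g_le orbT.
by rewrite (_ : 2 ^ 3 = 8)%N // (_ : 2 ^ 2 = 4)%N //; move: (2 ^ e)%N; clear; lia.
Qed.

Let lamE : lam = (e + g + k2)%N.
Proof. by rewrite /k2 /D; move: eg_lam; clear; lia. Qed.

Let T0 : (0 < T)%N.
Proof. by rewrite /T !muln_gt0 s0 lam0 expn_gt0. Qed.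

Let T_cube : (T ^ 3 <= 2 * n)%N.
Proof.
rewrite /T expnMn; apply: leq_trans exp3 _; have /andP[le _] := lam_log.
by apply: leq_trans le _; rewrite leq_pmull.
Qed.

Let D_le : (600 * (600 * (s * 2 ^ D)) <= n)%N.
Proof.
have /andP[le _] := lam_log; apply: leq_trans le.
have -> : lam = (e + D)%N by rewrite /D; move: eg_lam; clear; lia.
by rewrite expnD !mulnA leq_mul2r -!mulnA e_large orbT.
Qed.

Let lamD : (lam <= 2 ^ D)%N.
Proof.
rewrite -(leq_pmul2l (expn_gt0 2 e : (0 < 2 ^ e)%N)) -expnD.
have -> : (e + D = lam)%N by rewrite /D; move: eg_lam; clear; lia.
apply: leq_trans exp1; rewrite expn1 leq_mul2r; apply/orP; right.
by rewrite leq_exp2l // leq_addr.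
Qed.

Let hits (Y : nat) : (n * T <= 5 * s * Y)%N -> (8 * n ^ 2 <= 2 ^ k2 * Y)%N.
Proof.
move=> H; have s5 : (0 < 5 * s)%N by rewrite muln_gt0.
rewrite -(leq_pmul2l s5) [leqRHS]mulnCA.
apply: leq_trans (_ : 2 ^ k2 * (n * T) <= _)%N; last by rewrite leq_mul2l H orbT.
have -> : (5 * s * (8 * n ^ 2) = n * (40 * s * n))%N by rewrite expnS expn1; clear; lia.
rewrite [leqRHS]mulnCA leq_mul2l; apply/orP; right.
have /andP[_ lt] := lam_log.
apply: leq_trans (_ : 40 * s * 2 ^ lam.+1 <= _)%N; first by rewrite leq_mul2l ltnW ?orbT.
rewrite expnS lamE !expnD /T.
apply: leq_trans (_ : 40 * s * (2 * (2 ^ e * (2 * lam) * 2 ^ k2)) <= _)%N.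
  by rewrite leq_mul2l; apply/orP; right; rewrite leq_mul2l leq_mul2r leq_mul2l g_le !orbT.
move: (2 ^ e)%N (2 ^ k2)%N; clear => x y; rewrite leq_eqVlt; apply/orP; left; apply/eqP.
lia.
Qed.

Definition good_first (a : {ffun 'I_n -> 'I_n}) :=
  [&& [forall u, ~~ simple set0 a u N], (#|[set x | periodic a N x]| <= s * m)%N,
      (#|[set x | ~~ simple set0 a x q]| <= s)%N,
      (#|[set p : 'I_n * 'I_n | a p.1 == a p.2]| <= s * n)%N &
      (n * T <= 5 * s * #|[set p : 'I_n * 'I_n | iter T a p.1 == iter T a p.2]|)%N].

Definition good_second (a b : {ffun 'I_n -> 'I_n}) :=
  let S := [set x | ~~ simple set0 a x q] in
  [&& ~~ [exists x in S, b x \in S],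
      ~~ [exists y, [&& a y != y, b y \in S & b (a y) \in S]] &
      [forall x, forall y, [&& x != y, simple set0 a x q & simple set0 a y q] ==>
        (lam <= mergings_of_pair a q D T b x y)%N]].

Lemma prob_good_second a : good_first a ->
  avg (fun b => (~~ good_second a b)%:R) <= 3 / s%:R :> R.
Proof.
move=> /and5P[_ _ cS cc ch]; have V0 : (0 < #|'I_n|)%N by rewrite card_ord.
have s0' : 0 < s%:R :> R by rewrite ltr0n.
have n0' : 0 < n%:R :> R by rewrite ltr0n.
have B1 := prob_not_escaping R cS.
have B2 := prob_twice_into_set R V0 cS a.
have sn : (s ^ 2)%:R / #|'I_n|%:R <= s%:R^-1 :> R.
  rewrite card_ord ler_pdivrMr // mulrC ler_pdivlMr // -natrM ler_nat.
  have /andP[le _] := lam_log; apply: leq_trans le; apply: leq_trans exp5.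
  rewrite expn0 muln1 mulnC -expnS leq_exp2r // leq_pmull //.
have fix_le : (#|[set x | a x == x]| <= s)%N.
  apply: leq_trans cS; apply: subset_leq_card; apply/subsetP => x; rewrite !inE => /eqP ax.
  apply/negP => sx; have := simple_neq sx (isT : 0 < 1)%N.
  by rewrite q39 /= ax eqxx => /(_ isT).
have cc' : (#|[set p : 'I_n * 'I_n | a p.1 == a p.2]| <= s * #|'I_n|)%N by rewrite card_ord.
have D_le' : (600 * (600 * (s * 2 ^ D)) <= #|'I_n|)%N by rewrite card_ord.
have q_ge : (39 <= q)%N by rewrite q39.
have k2_ge : (2 <= k2)%N by rewrite /k2 /D; move: eg_lam; clear; lia.
have k2_D : (k2 <= D)%N by rewrite leq_subr.
have k2_lt : (k2 < 2 ^ (D - k2))%N.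
  have -> : (D - k2 = g)%N by rewrite /k2 /D; move: eg_lam; clear; lia.
  by apply: leq_ltn_trans g_gt; rewrite [leqRHS]lamE leq_addl.
have hits' := hits ch; rewrite -{1}[n]card_ord in hits'.
have B3 := prob_all_pairs_merge R V0 s0 cc' fix_le D_le' q_ge k2_ge k2_D k2_lt hits' lamD.
rewrite card_ord in B3.
(* Up to [2 ^ (4 * e + 4 * g)], [2 ^ (4 * k2)] equals [2 ^ (4 * lam)], against fewer than
   [2 ^ (2 * lam + 2)] pairs and the Markov factor [2 ^ lam]; the spare [2 ^ lam] absorbs the rest
   by [exp2]. *)
have B3' : (n ^ 2)%:R * (2 ^+ lam * (3 / 4) ^+ (10 * k2)) <= s%:R^-1 :> R.
  have p0 : 0 < 2 ^+ (4 * k2) :> R by rewrite exprn_gt0.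
  apply: le_trans (_ : (n ^ 2)%:R * (2 ^+ lam * (2 ^+ (4 * k2))^-1) <= _).
    by rewrite ler_wpM2l ?ler0n // ler_wpM2l ?exprn_ge0 // failure_tail.
  rewrite mulrA ler_pdivrMr // [leRHS]mulrC ler_pdivlMr // -!natrX -!natrM ler_nat.
  apply: leq_trans (_ : (2 ^ lam.+1) ^ 2 * 2 ^ lam * s <= _)%N.
    rewrite leq_mul2r leq_mul2r leq_exp2r // ltnW ?orbT //; by have /andP[] := lam_log.
  rewrite -(leq_pmul2l (expn_gt0 2 (4 * e + 4 * g) : (0 < 2 ^ (4 * e + 4 * g))%N)).
  have -> : (2 ^ (4 * e + 4 * g) * 2 ^ (4 * k2) = 2 ^ (3 * lam) * 2 ^ lam)%N.
    by rewrite -!expnD; congr (2 ^ _)%N; rewrite [in RHS]lamE; clear; lia.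
  have -> : ((2 ^ lam.+1) ^ 2 * 2 ^ lam = 2 ^ (3 * lam) * 2 ^ 2)%N.
    by rewrite -expnM -!expnD; congr (2 ^ _)%N; clear; lia.
  rewrite -mulnA mulnCA leq_mul2l; apply/orP; right; apply: leq_trans exp2.
  apply: leq_trans (_ : 2 ^ (4 * e) * (2 * lam) ^ 4 * (2 ^ 2 * s) <= _)%N.
    by rewrite leq_mul2r expnD leq_mul2l [(4 * g)%N]mulnC (expnM 2 g 4) leq_exp2r // g_le !orbT.
  by rewrite expnMn expnD (expnD 2 2 4); move: (2 ^ (4 * e))%N (lam ^ 4)%N; clear; lia.
apply: le_trans (_ : s%:R^-1 + s%:R^-1 + s%:R^-1 <= _); last by lra.
have := lerD (lerD (le_trans B1 sn) (le_trans B2 sn)) (le_trans B3 B3').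
apply: le_trans; rewrite -!avgD; apply: le_avg => b.
rewrite -!natrD ler_nat /good_second !negb_and !negbK; case: [exists x in _, _] => //=.
by case: [exists y, _] => //=; case: [forall x, _].
Qed.

Let m0 : (0 < m)%N.
Proof.
have /andP[_] := m_sqrt; case: (m) => // lt1.
by move: n0; rewrite lt0n => /eqP []; move: lt1; rewrite exp1n ltnS leqn0 => /eqP.
Qed.

Let n_le : (n <= 4 * m ^ 2)%N.
Proof.
have /andP[_ lt] := m_sqrt; apply: leq_trans (ltnW lt) _.
have -> : (4 * m ^ 2 = (2 * m) ^ 2)%N by rewrite expnMn.
rewrite leq_exp2r //.
by move: m0; clear; lia.
Qed.

Let markov (f : {ffun 'I_n -> 'I_n} -> nat) k (x : R) : (0 < k)%N ->
  avg (fun a => (f a)%:R) <= x -> avg (fun a => (~~ (f a <= k))%N%:R) <= x / k%:R.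
Proof.
move=> k0 fx; have k0' : 0 < k%:R :> R by rewrite ltr0n.
apply: le_trans (_ : avg (fun a => (f a)%:R) / k%:R <= _); last by rewrite ler_wpM2r ?invr_ge0 ?ler0n.
apply: le_trans (avg_markov k0' _); last by move=> a; rewrite ler0n.
by apply: le_avg => a; rewrite ltr_nat ltnNge.
Qed.

(** The five events cost [1], [5], [q ^ 2], [2] and [1] over [s]; the 5 is [m + n / m <= 5 * m] for
    the periodic states. *)
Lemma prob_good_first :
  avg (fun a => (~~ good_first a)%:R) <= (q ^ 2 + 9)%:R / s%:R :> R.
Proof.
have V0 : (0 < #|'I_n|)%N by rewrite card_ord.
have s0' : 0 < s%:R :> R by rewrite ltr0n.
have m0' : 0 < m%:R :> R by rewrite ltr0n.
have m_sqrt' : (m ^ 2 <= #|'I_n| < m.+1 ^ 2)%N by rewrite card_ord.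
have B1 : avg (fun a : {ffun 'I_n -> 'I_n} => (~~ [forall u, ~~ simple set0 a u N])%:R) <= s%:R^-1 :> R.
  apply: le_trans (_ : avg (fun a : {ffun 'I_n -> 'I_n} => \sum_u (simple set0 a u N)%:R) <= _).
    apply: le_avg => a; case: forallP => [_|/forallP]; first by apply: sumr_ge0.
    rewrite negb_forall => /existsP[u /negPn su].
    by rewrite (bigD1 u) //= su lerDl sumr_ge0.
  rewrite avg_sum (eq_bigr _ (fun u _ => prob_simple R V0 u N)) sumr_const card_ord -[_ *+ _]mulr_natr.
  apply: le_trans (_ : 4^-1 ^+ lam * (2 ^ lam.+1)%:R <= _).
    apply: ler_pM; rewrite ?ler0n ?birthday_ge0 //; first exact: birthday_tail.
    by rewrite ler_nat ltnW //; have /andP[] := lam_log.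
  rewrite -[leRHS]mul1r ler_pdivlMr // expnS natrM natrX.
  have p0 : 0 < 2 ^+ lam :> R by rewrite exprn_gt0.
  have -> : 4^-1 ^+ lam = (2 ^+ lam)^-1 * (2 ^+ lam)^-1 :> R.
    by rewrite exprVn -invfM -exprMn; congr (_ ^+ _)^-1; lra.
  have -> : (2 ^+ lam)^-1 * (2 ^+ lam)^-1 * (2 * 2 ^+ lam) * s%:R = (2 * s)%:R / 2 ^+ lam :> R.
    by rewrite natrM; field; rewrite gt_eqF.
  rewrite ler_pdivrMr // mul1r -natrX ler_nat; apply: leq_trans exp5.
  rewrite expn0 muln1 expnS leq_pmulr // expn_gt0 muln_gt0 s0 //.
have B2 : avg (fun a : {ffun 'I_n -> 'I_n} => (~~ (#|[set x | periodic a N x]| <= s * m))%N%:R) <= 5 / s%:R :> R.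
  have -> : 5 / s%:R = 5 * m%:R / (s * m)%:R :> R by rewrite natrM; field; rewrite !gt_eqF.
  apply: markov; first by rewrite muln_gt0 s0.
  apply: le_trans (avg_card_periodic R V0 N) _.
  apply: le_trans (sum_birthday_le R V0 N (m := m) _) _.
    rewrite m0 card_ord; have /andP[le _] := m_sqrt; apply: leq_trans le.
    by rewrite expnS expn1 leq_pmulr.
  rewrite card_ord; have : n%:R / m%:R <= 4 * m%:R :> R.
    rewrite ler_pdivrMr // -!natrM ler_nat; apply: leq_trans n_le _.
    by rewrite expnS expn1 mulnA.
  lra.
have B3 : avg (fun a : {ffun 'I_n -> 'I_n} => (~~ (#|[set x | ~~ simple set0 a x q]| <= s))%N%:R) <= (q ^ 2)%:R / s%:R :> R.
  by apply: markov => //; apply: avg_card_not_simple.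
have B4 : avg (fun a : {ffun 'I_n -> 'I_n} => (~~ (#|[set p : 'I_n * 'I_n | a p.1 == a p.2]| <= s * n))%N%:R) <= 2 / s%:R :> R.
  have n0' : 0 < n%:R :> R by rewrite ltr0n.
  have -> : 2 / s%:R = 2 * n%:R / (s * n)%:R :> R by rewrite natrM; field; rewrite !gt_eqF.
  apply: markov; first by rewrite muln_gt0 s0.
  by have := avg_card_equal_pairs R V0; rewrite card_ord.
have B5 : avg (fun a : {ffun 'I_n -> 'I_n} =>
    (~~ (n * T <= 5 * s * #|[set p : 'I_n * 'I_n | iter T a p.1 == iter T a p.2]|)%N)%:R) <= s%:R^-1 :> R.
  have T_cube' : (T ^ 3 <= 2 * #|'I_n|)%N by rewrite card_ord.
  have := prob_few_collisions R V0 T0 T_cube' s0; rewrite card_ord.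
  by apply: le_trans; apply: le_avg => a; rewrite ltnNge.
have := lerD (lerD (lerD (lerD B1 B2) B3) B4) B5.
have -> : s%:R^-1 + 5 / s%:R + (q ^ 2)%:R / s%:R + 2 / s%:R + s%:R^-1 = (q ^ 2 + 9)%:R / s%:R :> R.
  by rewrite natrD; ring.
apply: le_trans; rewrite -!avgD; apply: le_avg => a.
rewrite -!natrD ler_nat /good_first !negb_and.
case: (~~ [forall u, _]) => //; case: (~~ (_ <= s * m)%N) => //; case: (~~ (_ <= s)%N) => //.
by case: (~~ (_ <= s * n)%N) => //; case: (~~ _).
Qed.

Let c_ge : (44 <= c)%N. Proof. by rewrite /c leq_addl. Qed.

Let c_lam : (q + (2 * D + 1 + T) + 2 <= c * lam)%N.
Proof.
have -> : (c * lam = T + 44 * lam)%N by rewrite /c mulnDl.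
have Dl : (D <= lam)%N by rewrite leq_subr.
by rewrite q39; move: Dl lam0 T; clear; lia.
Qed.

Let M := (m %/ c)%N.

(** Since [(M - s).-1] is at least [m / (2 * c)], the right side is at least
    [lam * m ^ 2 / (4 * c ^ 2)], and the left is at most [160 * m ^ 2 * r ^ 2]. Both have order
    [m ^ 2] up to the factor [lam], which exceeds [640 * c ^ 2 * r ^ 2]. *)
Let shrink_cond : (q.+1 * 2 ^ D * (r * r.-1) < lam * ((M - s) * (M - s).-1))%N.
Proof.
have c0 : (0 < c)%N by apply: leq_trans c_ge.
have cm : (2 * (c * (s + 2)) <= m)%N.
  have /andP[_ lt] := m_sqrt; have /andP[le _] := lam_log.
  rewrite -ltnS -(ltn_exp2r _ _ (isT : 0 < 2)%N).
  by apply: leq_ltn_trans lt; apply: leq_trans le; apply: leq_trans exp4;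
    rewrite expn0 muln1 leq_exp2r // leq_addr.
pose X := (M - s).-1.
have mX : (m <= 2 * c * X)%N.
  have := divn_eq m c; have := ltn_mod m c; rewrite c0 -/M => lt mE.
  have cX : (c * X = c * M - c * s - c)%N by rewrite /X -subn1 !mulnBr muln1.
  move: cX mE lt cm; rewrite -mulnA => ->; rewrite mulnDr mulnC; clear.
  by move: (c * M)%N (c * s)%N (m %% c)%N => x y z; lia.
have c4 : (0 < (2 * c) ^ 2)%N by rewrite expn_gt0 muln_gt0 c0.
rewrite -(ltn_pmul2l c4).
apply: leq_trans (_ : lam * (2 * c * X) ^ 2 <= _)%N; last first.
  rewrite expnMn mulnCA leq_mul2l; apply/orP; right; rewrite leq_mul2l; apply/orP; right.
  by rewrite expnS expn1 leq_mul // /X leq_pred.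
apply: leq_trans (_ : lam * m ^ 2 <= _)%N; last by rewrite leq_mul2l leq_exp2r ?mX ?orbT.
apply: leq_ltn_trans (_ : 640 * (c ^ 2 * r ^ 2) * m ^ 2 < _)%N; last first.
  by rewrite ltn_mul2r lam_gt andbT expn_gt0 m0.
have Dn : (2 ^ D <= 4 * m ^ 2)%N.
  apply: leq_trans n_le; have /andP[le _] := lam_log; apply: leq_trans le.
  by rewrite leq_exp2l // leq_subr.
have rr : (r * r.-1 <= r ^ 2)%N by rewrite expnS expn1 leq_mul2l leq_pred orbT.
apply: leq_trans (_ : (2 * c) ^ 2 * (40 * (4 * m ^ 2) * r ^ 2) <= _)%N.
  by rewrite leq_mul2l leq_mul ?orbT // q39 leq_mul2l Dn orbT.
rewrite expnMn; move: (c ^ 2)%N (r ^ 2)%N (m ^ 2)%N; clear => x y z.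
by rewrite leq_eqVlt; apply/orP; left; apply/eqP; lia.
Qed.

(** [N] is at most [9 * m * lam], and each of the two shrinking phases costs at most [m * lam]; so
    11 does not depend on [s]. *)
Lemma good_synchronizing (A : automaton n) : good_first A.1 -> good_second A.1 A.2 ->
  exists2 w, synchronizing A w & (size w <= 11 * m * lam)%N.
Proof.
move=> /and5P[/forallP long per ss _ _] /and3P[esc twice mer].
have q0 : (0 < q)%N by rewrite q39.
have r0 : (0 < r)%N by rewrite muln_gt0 s0 (leq_trans _ c_ge).
have imZ : (#|image_iter A.1 N| <= s * m)%N.
  apply: leq_trans per; apply: subset_leq_card; apply/subsetP => x /imsetP[u _ ->].
  by rewrite inE iter_periodic.
have HL : ((q + (2 * D + 1 + T)) * (s * m) <= r * (m * lam))%N.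
  have := c_lam; move: (q + (2 * D + 1 + T))%N => l ll.
  apply: leq_trans (_ : c * lam * (s * m) <= _)%N.
    by rewrite leq_mul2r (leq_trans _ ll) ?orbT // leq_addr.
  by rewrite /r; move: c lam; clear => x y; rewrite leq_eqVlt; apply/orP; left; apply/eqP; lia.
have [|||w sw lw] := synchronizing_word lam0 _ _ _ n0 r0 ss imZ shrink_cond HL.
- move=> x y xy sx sy; have /forallP/(_ x)/forallP/(_ y)/implyP := mer; apply.
  by rewrite xy sx sy.
- move=> x xS; have := esc; rewrite negb_exists => /forallP/(_ x).
  by rewrite xS.
- move=> y yS; have := twice; rewrite negb_exists => /forallP/(_ y).
  rewrite !negb_and => /orP[|//]; rewrite negbK => /eqP ay.
  move: yS; rewrite inE negbK => sy.
  by have := simple_neq sy (isT : 0 < 1)%N q0; rewrite /= ay eqxx.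
exists w => //; apply: leq_trans lw _.
have lM : ((q + (2 * D + 1 + T) + 2) * M <= m * lam)%N.
  apply: leq_trans (_ : c * lam * M <= _)%N; first by rewrite leq_mul2r c_lam orbT.
  by rewrite mulnAC leq_mul2r [(c * M)%N]mulnC leq_trunc_div orbT.
apply: leq_trans (_ : N + m * lam + m * lam <= _)%N; first by rewrite leq_add2l.
rewrite /N; have : (m <= m * lam)%N by rewrite leq_pmulr.
rewrite -!mulnA; move: (m * lam)%N; clear; lia.
Qed.

Lemma prob_short_synchronizing :
  exists G : pred (automaton n),
    avg (fun A => (~~ G A)%:R) <= (q ^ 2 + 12)%:R / s%:R :> R /\
    forall A, G A -> exists2 w, synchronizing A w & (size w <= 11 * m * lam)%N.
Proof.
exists (fun A => good_first A.1 && good_second A.1 A.2); split; last first.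
  by move=> A /andP[]; apply: good_synchronizing.
rewrite avg_pair /=.
have F0 : (0 < #|{ffun 'I_n -> 'I_n}|)%N by apply/card_gt0P; exists [ffun=> Ordinal n0].
apply: le_trans (_ : avg (fun a => (~~ good_first a)%:R + 3 / s%:R) <= _).
  apply: le_avg => a; have [ga|_] := boolP (good_first a).
    by rewrite /= add0r; apply: prob_good_second.
  rewrite /= avg_cst // lerDl divr_ge0 //.
rewrite avgD avg_cst //; have := prob_good_first; rewrite !natrD => H.
by move: H; rewrite !mulrDl; lra.
Qed.

End RandomAutomaton.


(** The order of choices matters: [s] fixes the error, [e] and [c] depend on [s] alone, and [n0]
    comes last so that [lam] dominates every constant built from them. *)
Lemma eventually_short_synchronizing (R : realFieldType) (s : nat) : (0 < s)%N ->
  exists n0, forall n, (n0 <= n)%N -> exists m lam (G : pred (automaton n)),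
    [/\ (m ^ 2 <= n)%N, (2 ^ lam <= n)%N,
      avg (fun A => (~~ G A)%:R) <= (39 ^ 2 + 12)%:R / s%:R :> R &
      forall A, G A -> exists2 w, synchronizing A w & (size w <= 11 * m * lam)%N].
Proof.
move=> s0.
have [e he] : exists e, (600 * (600 * s) <= 2 ^ e)%N.
  by exists (600 * (600 * s))%N; apply/ltnW/ltn_expl.
pose c := (160 * s * 2 ^ e + 44)%N.
have [L1 H1] := poly_le_exp (2 ^ (e + 3)) 1.
have [L2 H2] := poly_le_exp (s * 2 ^ (4 * e + 6)) 4.
have [L3 H3] := poly_le_exp ((160 * s * 2 ^ e) ^ 3) 3.
have [L4 H4] := poly_le_exp ((2 * (c * (s + 2)) + 1) ^ 2) 0.
have [L5 H5] := poly_le_exp ((2 * s) ^ 3) 0.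
pose L := (maxn (640 * (c ^ 2 * (s * c) ^ 2)).+1 (maxn L1 (maxn L2 (maxn L3 (maxn L4 L5)))))%N.
exists (2 ^ L)%N => n nL.
have n0 : (0 < n)%N by apply: leq_trans nL; rewrite expn_gt0.
have lamL : (L <= trunc_log 2 n)%N by apply: trunc_log_max.
have lam_log := trunc_log_bounds (isT : 1 < 2)%N n0.
have [m m_sqrt] := exists_isqrt n.
have := lamL; rewrite !geq_max => /and5P[lam0 l1 l2 l3 /andP[l4 l5]].
have [G [PG GP]] := prob_short_synchronizing R s0 (erefl 39) m_sqrt lam_log he lam0
  (H1 _ l1) (H2 _ l2) (H3 _ l3) (H4 _ l4) (H5 _ l5).
exists m, (trunc_log 2 n), G; split => //.
  by have /andP[] := m_sqrt.
by have /andP[] := lam_log.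
Qed.

(* Passage to real logarithms and to the limit *)
From mathcomp Require Import all_classical all_reals all_analysis.

Import numFieldNormedType.Exports.

Local Open Scope classical_set_scope.

Lemma size_le_sqrt_log (R : realType) (n m lam k : nat) :
  (m ^ 2 <= n)%N -> (2 ^ lam <= n)%N -> (k <= 11 * m * lam)%N ->
  k%:R <= 11 / ln 2 * Num.sqrt n%:R * ln n%:R :> R.
Proof.
move=> mn ln km.
have l2 : 0 < exp.ln 2 :> R by rewrite ln_gt0 // ltr1n.
apply: le_trans (_ : 11 * m%:R * lam%:R <= _); first by rewrite -!natrM ler_nat.
have mR : m%:R <= Num.sqrt n%:R :> R.
  by rewrite -[m%:R]ger0_norm // -sqrtr_sqr ler_wsqrtr // -natrX ler_nat.
have lR : lam%:R * exp.ln 2 <= exp.ln n%:R :> R.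
  rewrite mulr_natl -lnXn // ler_ln ?posrE ?exprn_gt0 // -?natrX ?ler_nat //.
  by rewrite ltr0n; apply: leq_trans ln; rewrite expn_gt0.
have -> : 11 / exp.ln 2 * Num.sqrt n%:R * exp.ln n%:R =
  11 * Num.sqrt n%:R * (exp.ln n%:R / exp.ln 2) :> R by ring.
apply: ler_pM; rewrite ?mulr_ge0 // ?ler_wpM2l //.
by rewrite ler_pdivlMr.
Qed.

Theorem theorem1p1 (R : realType) :
  exists C : R, 0 < C /\
    (fun n : nat =>
       finite_uniform_prob R (fun A : automaton n =>
         exists w : seq letter,
           synchronizing A w /\
           (size w)%:R <= C * Num.sqrt (n%:R : R) * ln (n%:R : R)))
      @ \oo --> (1 : R).
Proof.
(* [lam] is a logarithm to base 2, whence the division by [ln 2]. *)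
exists (11 / ln 2); split; first by rewrite divr_gt0 // ln_gt0 // ltr1n.
apply/cvgrPdist_le => eps eps0.
have [s s0 seps] : exists2 s, (0 < s)%N & (39 ^ 2 + 12)%:R / s%:R <= eps :> R.
  pose x : R := (39 ^ 2 + 12)%:R / eps.
  have x0 : 0 <= x by rewrite divr_ge0 // ltW.
  exists (Num.bound x).+1 => //; rewrite ler_pdivrMr ?ltr0n // mulrC -ler_pdivrMr //.
  by apply: ltW; apply: lt_le_trans (archi_boundP x0) _; rewrite ler_nat.
have [n0 n0P] := eventually_short_synchronizing R s0.
apply: filterS (nbhs_infty_ge n0) => n /n0P[m [lam [G [mn ln PG GP]]]].
set E := fun A : automaton n => _.
have card0 : (0 < #|automaton n|)%N.
  by rewrite card_prod muln_gt0 andbb; apply/card_gt0P; exists [ffun x => x].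
have <- : avg (fun A => `[< E A >]%:R) = finite_uniform_prob R E by rewrite avg_card.
have le1 : avg (fun A => `[< E A >]%:R) <= 1 :> R.
  by rewrite -[leRHS](avg_cst _ card0); apply: le_avg => A; case: asboolP.
rewrite ger0_norm ?subr_ge0 //; apply: le_trans seps; apply: le_trans PG.
rewrite -[X in X - _](avg_cst _ card0) -avgB; apply: le_avg => A.
have [GA|_] := boolP (G A); last by case: asboolP => _; rewrite ?subrr ?subr0 ?ler01.
have [w sw lw] := GP A GA; rewrite (_ : `[< E A >] = true) ?subrr //.
by apply/asboolP; exists w; split=> //; apply: size_le_sqrt_log mn ln lw.
Qed.
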